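(* Let $\theta<1$ be such that $f$ attains its minimum exactly at the uniaxial tensors $6q_+\left(n\otimes n-\frac13 I\right)$, $n\in\mathbb S^2$. For each $\lambda>0$ let $Q_\lambda\in\mathcal H$ be a minimizer of $E_\lambda$ over $\mathcal H$ whose third component satisfies $q_3(0)\ge 0$. Then $Q_\lambda\to Q_*$ in $H^1(-1,1)$ as $\lambda\to+\infty$, where $$Q_*(x)=6q_+\left(n_*(x)\otimes n_*(x)-\frac13 I\right),\qquad n_*(x)=\begin{pmatrix}0\\ \cos\left(\frac{\pi}{4}-\frac{\pi}{4}x\right)\\ \sin\left(\frac{\pi}{4}-\frac{\pi}{4}x\right)\end{pmatrix}.$$
   Context: Fix a parameter $\theta<1$ and set $q_+=\frac{1+\sqrt{1-\theta}}{6}$. A triple $(q_1,q_2,q_3)$ of real functions on $[-1,1]$ is identified with the symmetric traceless matrix-valued map $$Q(x)=\begin{pmatrix}-2q_1(x)&0&0\\0&q_1(x)-q_2(x)&q_3(x)\\0&q_3(x)&q_1(x)+q_2(x)\end{pmatrix}.$$ With $|Q|^2=\mathrm{tr}(Q^2)$, let $$f(Q)=\frac{\theta}{6}|Q|^2-\frac23\mathrm{tr}(Q^3)+\frac18|Q|^4+c(\theta)$$ on symmetric traceless $3\times3$ matrices, where the constant $c(\theta)$ is chosen so that $\min f=0$. Let $\mathcal H$ be the affine space of $Q=(q_1,q_2,q_3)\in H^1(-1,1)^3$ with $q_1(\pm1)=q_+$, $q_2(-1)=3q_+$, $q_2(1)=-3q_+$, $q_3(\pm1)=0$. For $\lambda>0$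 the energy on $\mathcal H$ is $$E_\lambda(Q)=\int_{-1}^1\left(\frac{1}{2\lambda^2}|Q'|^2+f(Q)\right)dx.$$ *)

(* Defs.v *)
From HB Require Import structures.
From mathcomp Require Import all_boot all_order all_algebra.
From mathcomp Require Import all_classical all_reals all_analysis.

Set Implicit Arguments.
Unset Strict Implicit.
Unset Printing Implicit Defensive.

Import Order.TTheory GRing.Theory Num.Theory.
Import numFieldNormedType.Exports.

Local Open Scope classical_set_scope.
Local Open Scope ring_scope.

Section Sobolev.
Context {R : realType}.
Implicit Types u g phi : R -> R.

Local Notation mu := (@lebesgue_measure R).
Definition Iopen : set R := `]-1, 1[.
Definition Iclosed : set R := `[-1, 1].

Definition inL2 g : Prop :=
  measurable_fun Iopen g /\ mu.-integrable Iopen (fun x => (g x ^+ 2)%:E).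

(* C^1 functions on R with (compact) support contained in ]-1, 1[, the test
   functions of Brezis's definition of H^1 of an interval; smooth ones would
   give the same weak derivatives. *)
Definition test_function phi : Prop :=
  [/\ forall x, derivable phi x 1,
      continuous (derive1 phi) &
      closure [set x | phi x != 0] `<=` Iopen].

Definition weak_derivative u g : Prop :=
  forall phi, test_function phi ->
    Rintegral mu Iopen (fun x => u x * derive1 phi x) =
    - Rintegral mu Iopen (fun x => g x * phi x).

(* As usual in dimension one, an element of H^1(-1, 1) is identified with its
   representative that is continuous on [-1, 1]; this gives a meaning to its
   pointwise values, in particular at the end points. Values outside [-1, 1]
   are irrelevant. *)
Definition inH1 u : Prop :=
  [/\ {within Iclosed, continuous u}, inL2 u &
      exists g, inL2 g /\ weak_derivative u g].

(* Some weak derivative of u (unique almost everywhere) when u is in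
   H^1(-1, 1). *)
Definition wderiv u : R -> R := get [set g | inL2 g /\ weak_derivative u g].

Definition wderivmx (M : R -> 'M[R]_3) : R -> 'M[R]_3 :=
  fun x => \matrix_(i, j) wderiv (fun y => M y i j) x.

End Sobolev.

Section QTensors.
Context {R : realType}.
Implicit Types (A : 'M[R]_3) (theta c lambda : R).

Definition sym_traceless A : Prop := A^T = A /\ \tr A = 0.

(* |A|^2 = tr(A^2), for symmetric A. *)
Definition normsq A : R := \tr (A *m A).

Definition qplus theta : R := (1 + Num.sqrt (1 - theta)) / 6.

Definition bulk theta c A : R :=
  theta / 6 * normsq A - 2 / 3 * \tr (A *m A *m A)
  + 1 / 8 * normsq A ^+ 2 + c.

Definition bulk_minimizer theta c A : Prop :=
  sym_traceless A /\
  forall B, sym_traceless B -> bulk theta c A <= bulk theta c B.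

(* The minimum of f over symmetric traceless matrices is 0; this determines c
   as a function of theta. *)
Definition bulk_min_zero theta c : Prop :=
  exists A, bulk_minimizer theta c A /\ bulk theta c A = 0.

Definition unit_vector (n : 'cV[R]_3) : Prop := \sum_i n i 0 ^+ 2 = 1.

Definition uniaxial theta (n : 'cV[R]_3) : 'M[R]_3 :=
  (6 * qplus theta) *: (n *m n^T - (1 / 3)%:M).

Record triple := Triple { q1 : R -> R; q2 : R -> R; q3 : R -> R }.

Definition Qmat (q : triple) (x : R) : 'M[R]_3 :=
  \matrix_(i, j) nth 0 (nth [::]
    [:: [:: - 2 * q1 q x; 0; 0];
        [:: 0; q1 q x - q2 q x; q3 q x];
        [:: 0; q3 q x; q1 q x + q2 q x]] i) j.

Definition inH theta (q : triple) : Prop :=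
  [/\ inH1 (q1 q), inH1 (q2 q) & inH1 (q3 q)] /\
  [/\ q1 q (-1) = qplus theta /\ q1 q 1 = qplus theta,
      q2 q (-1) = 3 * qplus theta /\ q2 q 1 = - (3 * qplus theta) &
      q3 q (-1) = 0 /\ q3 q 1 = 0].

(* For lambda > 0 and min f = 0 the integrand is nonnegative, and the energy is
   finite on inH. *)
Definition energy theta c lambda (q : triple) : \bar R :=
  (\int[@lebesgue_measure R]_(x in Iopen)
    (1 / (2 * lambda ^+ 2) * normsq (wderivmx (Qmat q) x)
     + bulk theta c (Qmat q x))%:E)%E.

Definition energy_minimizer theta c lambda (q : triple) : Prop :=
  inH theta q /\
  forall p, inH theta p -> (energy theta c lambda q <= energy theta c lambda p)%E.

Definition H1norm (M : R -> 'M[R]_3) : \bar R :=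
  sqrte (\int[@lebesgue_measure R]_(x in Iopen)
    (normsq (M x) + normsq (wderivmx M x))%:E)%E.

Definition nstar (x : R) : 'cV[R]_3 :=
  \col_i nth 0 [:: 0; cos (pi / 4 - pi / 4 * x); sin (pi / 4 - pi / 4 * x)] i.

Definition Qstar theta (x : R) : 'M[R]_3 := uniaxial theta (nstar x).

End QTensors.

Arguments triple R : clear implicits.

(* Main.v *)
Require Import Defs.
From HB Require Import structures.
From mathcomp Require Import all_boot all_order all_algebra.
From mathcomp Require Import all_classical all_reals all_analysis.
From mathcomp Require Import measurable_realfun.
From mathcomp Require Import ring lra.

Set Implicit Arguments.
Unset Strict Implicit.
Unset Printing Implicit Defensive.

Import Order.TTheory GRing.Theory Num.Theory.
Import numFieldNormedType.Exports.

Local Open Scope classical_set_scope.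
Local Open Scope ring_scope.

(** Write k for pi / 2, s for q_+ and rho for 3 s. The tensors of the block
form that minimize the bulk density are an isolated point and the circle
q1 = s, q2 ^ 2 + q3 ^ 2 = rho ^ 2. On this circle the boundary values are
antipodal, and Q_* is the half-turn (q2, q3) = rho (- sin k x, cos k x). The
bulk density vanishes along Q_*, so comparing a minimizer with Q_* gives

  int (3 q1' ^ 2 + q2' ^ 2 + q3' ^ 2) + lambda ^ 2 int f(Q) <= 2 rho ^ 2 k ^ 2

and everything is deduced from this inequality, with explicit constants.

Confinement (lemma [confinement]). The derivatives are bounded in L^2, so the
components are uniformly Hoelder continuous of exponent 1/2. If the value
q2 ^ 2 + q3 ^ 2 left a neighbourhood of rho ^ 2, it would remain for a definite
length in a strip where f is bounded below by a positive constant, which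
contradicts int f(Q) = O(lambda ^ -2). Hence q2 ^ 2 + q3 ^ 2 is uniformly close
to rho ^ 2 for large lambda.

Rigidity (lemma [close_to_geodesic]). Both w2 = q2 + rho sin k x and q3 vanish
at -1 and 1, and their deficits in the sharp Poincare inequality
k ^ 2 int z ^ 2 <= int z' ^ 2 add up to
int (q2' ^ 2 + q3' ^ 2) - k ^ 2 int (q2 ^ 2 + q3 ^ 2) (lemma [poincare_sum]),
which is small by confinement. The deficit of z controls the uniform distance
from z to z(0) cos k x (lemma [poincare_defect]). So w2 and q3 are close to
a cos k x and b cos k x, where a = q2(0) and b = q3(0). Since q2 ^ 2 + q3 ^ 2
is close to rho ^ 2 at the points 0 and 1/2, a is close to 0 and b to rho or
- rho (lemma [rigidity_two_points]). The value - rho is the opposite half-turn,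
which the hypothesis q3(0) >= 0 excludes.

Strong convergence (lemma [kinetic_gap]). As Q_* solves the equation
v'' = - k ^ 2 v, an integration by parts in the comparison inequality bounds
the kinetic energy of Q - Q_* by the uniform distance just estimated.

In dimension one a function of H^1 is a primitive of its weak derivative, so the
calculus is done on pairs [primL2 u g] of a function and a density. The product
rule [primL2M] is the only tool needed from the theory of absolutely continuous
functions; [weak_derivative_primL2], [primL2_weak_derivative] and
[density_unique] make the link with weak derivatives. *)

(** * Calculus of primitives of square-integrable functions *)

Section Primitives.
Context {R : realType}.
Implicit Types (u v f g h : R -> R) (a b c r : R).
Local Notation mu := (@lebesgue_measure R).
Local Notation Io := (@Iopen R).
Local Notation Ic := (@Iclosed R).
Local Notation mR := (@measurable _ (g_sigma_algebraType R.-ocitv.-measurable)).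

Definition inL1 f : Prop := mu.-integrable Io (EFin \o f).

(** The bounds are excluded so that the interval lies in ]-1, 1[, where the
densities are square integrable, even when a = -1 or b = 1. *)
Definition intg a b f : R := Rintegral mu `]a, b[ f.

Lemma Iopen_measurable : mR Io. Proof. exact: measurable_itv. Qed.

Lemma oo_measurable a b : mR `]a, b[.
Proof. exact: measurable_itv. Qed.

Lemma oo_subIopen a b : -1 <= a -> b <= 1 -> `]a, b[ `<=` Io.
Proof.
by move=> a1 b1 x; rewrite /Iopen /= !in_itv /= => /andP[ax xb]; apply/andP;
  split; [exact: le_lt_trans ax|exact: lt_le_trans b1].
Qed.

Lemma inL1_oo f a b : -1 <= a -> b <= 1 -> inL1 f ->
  mu.-integrable `]a, b[ (EFin \o f).
Proof.
by move=> a1 b1; apply: integrableS;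
  [exact: Iopen_measurable|exact: oo_measurable|exact: oo_subIopen].
Qed.

Lemma inL1_ext f g : (forall x, Io x -> f x = g x) -> inL1 f -> inL1 g.
Proof.
move=> fg; apply: eq_integrable; first exact: Iopen_measurable.
by move=> x; rewrite inE => Ix; rewrite /= fg.
Qed.

Lemma inL1D f g : inL1 f -> inL1 g -> inL1 (fun x => f x + g x).
Proof. by move=> hf hg; exact: (integrableD Iopen_measurable hf hg). Qed.

Lemma inL1Z f r : inL1 f -> inL1 (fun x => r * f x).
Proof. by move=> hf; exact: (integrableZl Iopen_measurable r hf). Qed.

Lemma inL1B f g : inL1 f -> inL1 g -> inL1 (fun x => f x - g x).
Proof. by move=> hf hg; exact: (integrableB Iopen_measurable hf hg). Qed.

Lemma inL1_dom f g : measurable_fun Io f -> inL1 g ->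
  (forall x, Io x -> `|f x| <= g x) -> inL1 f.
Proof.
move=> mf ig fg; apply: le_integrable ig => //; first exact: Iopen_measurable.
  exact/measurable_EFinP.
move=> x Ix; rewrite /= lee_fin; apply: le_trans (fg x Ix) _.
exact: ler_norm.
Qed.

Lemma inL2_mul f g : inL2 f -> inL2 g -> inL1 (fun x => f x * g x).
Proof.
move=> [mf if2] [mg ig2].
apply: (@inL1_dom _ (fun x => f x ^+ 2 + g x ^+ 2)).
- exact: measurable_funM.
- exact: inL1D.
- move=> x _; rewrite ler_norml; apply/andP; split; nra.
Qed.

Lemma inL2_sqr f : inL2 f -> inL1 (fun x => f x ^+ 2).
Proof. by case. Qed.

Lemma wcont_meas u : {within Ic, continuous u} -> measurable_fun Io u.
Proof.
move=> cu; apply: (@measurable_funS _ _ _ _ Ic).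
- exact: measurable_itv.
- by move=> x; rewrite /Iopen /Iclosed /= !in_itv /= => /andP[/ltW -> /ltW ->].
- by apply: subspace_continuous_measurable_fun => //; exact: measurable_itv.
Qed.

Lemma wcont_bounded u : {within Ic, continuous u} ->
  exists2 M, 0 <= M & forall x, Ic x -> `|u x| <= M.
Proof.
move=> cu.
have cn : {within `[-1, 1], continuous (fun x => `|u x|)}.
  by move=> x; apply: cvg_norm; exact: (cu x).
have N11 : -1 <= 1 :> R by lra.
have [c _ hc] := EVT_max N11 cn.
exists `|u c| => // x Ix; exact: hc.
Qed.

Lemma inL1_cst r : inL1 (fun=> r).
Proof.
apply: measurable_bounded_integrable; first exact: Iopen_measurable.
- have h : (mu (`](-1)%R, 1%R[%classic : set R) < +oo)%E.
    by rewrite lebesgue_measure_itv /=; case: ifP; rewrite ?ltry.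
  exact: h.
- exact: measurable_cst.
- by exists `|r|; split; [rewrite num_real|move=> M rM x _; exact: ltW].
Qed.

Lemma wcont_L1 u : {within Ic, continuous u} -> inL1 u.
Proof.
move=> cu; have [M _ hM] := wcont_bounded cu.
apply: (@inL1_dom _ (fun=> M)); [exact: wcont_meas|exact: inL1_cst|].
by move=> x; rewrite /Iopen /= in_itv /= => /andP[/ltW x1 /ltW x2];
  apply: hM; rewrite /Iclosed /= in_itv /= x1.
Qed.

Lemma wcontM u v : {within Ic, continuous u} -> {within Ic, continuous v} ->
  {within Ic, continuous (fun x => u x * v x)}.
Proof. by move=> cu cv x; apply: continuousM; [exact: cu|exact: cv]. Qed.

Lemma wcontD u v : {within Ic, continuous u} -> {within Ic, continuous v} ->
  {within Ic, continuous (fun x => u x + v x)}.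
Proof. by move=> cu cv x; apply: continuousD; [exact: cu|exact: cv]. Qed.

Lemma wcont_cst r : {within Ic, continuous (fun=> r)}.
Proof. by move=> x; exact: cst_continuous. Qed.

Lemma wcontZ u r : {within Ic, continuous u} ->
  {within Ic, continuous (fun x => r * u x)}.
Proof. by move=> cu; apply: wcontM => //; exact: wcont_cst. Qed.

Lemma wcontB u v : {within Ic, continuous u} -> {within Ic, continuous v} ->
  {within Ic, continuous (fun x => u x - v x)}.
Proof. by move=> cu cv x; apply: continuousB; [exact: cu|exact: cv]. Qed.

Lemma wcontX u n : {within Ic, continuous u} ->
  {within Ic, continuous (fun x => u x ^+ n)}.
Proof.
move=> cu; elim: n => [|n IH]; first exact: wcont_cst.
under [X in continuous X]eq_fun do rewrite exprS.
exact: wcontM.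
Qed.

Lemma wcont_L2 u : {within Ic, continuous u} -> inL2 u.
Proof.
by move=> cu; split; [exact: wcont_meas|apply: wcont_L1; exact: wcontX].
Qed.

Lemma inL2_cst r : inL2 (fun=> r).
Proof. by apply: wcont_L2; exact: wcont_cst. Qed.

Lemma inL2_L1 f : inL2 f -> inL1 f.
Proof.
move=> hf; have := inL2_mul hf (inL2_cst 1).
by apply: inL1_ext => x _; rewrite mulr1.
Qed.

Lemma inL2D f g : inL2 f -> inL2 g -> inL2 (fun x => f x + g x).
Proof.
move=> hf hg; split; first by apply: measurable_funD; [case: hf|case: hg].
have : inL1 (fun x => f x ^+ 2 + 2 * (f x * g x) + g x ^+ 2).
  by apply: inL1D; [apply: inL1D; [exact: inL2_sqr|
    apply: inL1Z; exact: inL2_mul]|exact: inL2_sqr].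
by apply: inL1_ext => x _; ring.
Qed.

Lemma inL2_bM u f : {within Ic, continuous u} -> inL2 f ->
  inL2 (fun x => u x * f x).
Proof.
move=> cu hf; have [M M0 hM] := wcont_bounded cu; split.
  by apply: measurable_funM; [exact: wcont_meas|case: hf].
apply: (@inL1_dom _ (fun x => M ^+ 2 * f x ^+ 2)).
- by apply: measurable_funX; apply: measurable_funM; [exact: wcont_meas|
    case: hf].
- by apply: inL1Z; exact: inL2_sqr.
- move=> x Ix; rewrite ger0_norm ?sqr_ge0// exprMn ler_wpM2r ?sqr_ge0//.
  rewrite -[leLHS]real_normK ?num_real// ler_pXn2r ?nnegrE//.
  apply: hM; move: Ix; rewrite /Iopen /Iclosed /= !in_itv /=.
  by case/andP => /ltW -> /ltW ->.
Qed.

Lemma inL2Z f r : inL2 f -> inL2 (fun x => r * f x).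
Proof. by apply: inL2_bM; exact: wcont_cst. Qed.

Lemma inL2B f g : inL2 f -> inL2 g -> inL2 (fun x => f x - g x).
Proof.
move=> hf /(inL2Z (-1)) hg; have := inL2D hf hg.
by congr inL2; apply/funext => x; rewrite mulN1r.
Qed.

Lemma eq_intg a b f g : (forall x, a < x < b -> f x = g x) ->
  intg a b f = intg a b g.
Proof.
by move=> fg; apply: eq_Rintegral => x; rewrite inE /= in_itv /=; exact: fg.
Qed.

Lemma intg_nil a b f : b <= a -> intg a b f = 0.
Proof.
by move=> ba; rewrite /intg set_itv_ge ?Rintegral_set0// bnd_simp -leNgt.
Qed.

Section Bounds.
Variables (a b : R).
Hypotheses (a1 : -1 <= a) (b1 : b <= 1).

Lemma intgD f g : inL1 f -> inL1 g ->
  intg a b (fun x => f x + g x) = intg a b f + intg a b g.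
Proof.
by move=> hf hg; apply: RintegralD; rewrite ?oo_measurable//; exact: inL1_oo.
Qed.

Lemma intgB f g : inL1 f -> inL1 g ->
  intg a b (fun x => f x - g x) = intg a b f - intg a b g.
Proof.
by move=> hf hg; apply: RintegralB; rewrite ?oo_measurable//; exact: inL1_oo.
Qed.

Lemma intgZ f r : inL1 f -> intg a b (fun x => r * f x) = r * intg a b f.
Proof.
by move=> hf; apply: RintegralZl; rewrite ?oo_measurable//; exact: inL1_oo.
Qed.

Lemma intg_le f g : inL1 f -> inL1 g ->
  (forall x, a < x < b -> f x <= g x) -> intg a b f <= intg a b g.
Proof.
move=> hf hg fg; apply: le_Rintegral.
- exact: oo_measurable.
- exact: inL1_oo.
- exact: inL1_oo.
- by move=> x; rewrite /= in_itv /=; exact: fg.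
Qed.

Lemma intg_ge0 f : (forall x, a < x < b -> 0 <= f x) -> 0 <= intg a b f.
Proof.
by move=> f0; apply: Rintegral_ge0 => x; rewrite /= in_itv /=; exact: f0.
Qed.

Lemma intg_cst r : a <= b -> intg a b (fun=> r) = r * (b - a).
Proof.
move=> ab; rewrite /intg Rintegral_cst ?oo_measurable//.
congr (r * _).
transitivity (fine (mu (`]a, b[%classic : set R))) => //.
rewrite lebesgue_measure_itv /= lte_fin; have [//|ba] := ltP a b.
by rewrite /= (_ : b = a) ?subrr//; apply/le_anti; rewrite ab ba.
Qed.

Lemma le_norm_intg f g : inL1 f -> inL1 g ->
  (forall x, a < x < b -> `|f x| <= g x) -> `|intg a b f| <= intg a b g.
Proof.
move=> hf hg fg; rewrite ler_norml -mulN1r -intgZ//; apply/andP; split.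
  apply: intg_le => // [|x /fg]; first exact: inL1Z.
  by rewrite mulN1r ler_norml => /andP[].
by apply: intg_le => // x /fg; exact/le_trans/ler_norm.
Qed.

Lemma intg_chasles_lt f c : inL1 f -> a < c -> c < b ->
  intg a b f = intg a c f + intg c b f.
Proof.
move=> hf ac cb; have cb1 := ltW (lt_le_trans cb b1).
have hac : mu.-integrable `]a, c[ (EFin \o f) by apply: inL1_oo.
have hacc : mu.-integrable `]a, c] (EFin \o f).
  apply: integrableS (inL1_oo a1 b1 hf).
  - exact: oo_measurable.
  - exact: measurable_itv.
  - by move=> x; rewrite /= !in_itv /= => /andP[-> /le_lt_trans ->].
rewrite [intg a c f]/intg Rintegral_itv_bndo_bndc//.
have eU : `]a, b[%classic = `]a, c] `|` `]c, b[ :> set R.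
  by apply: itv_bndbnd_setU; rewrite bnd_simp ?ltW.
rewrite /intg eU Rintegral_setU//.
- by rewrite -eU; exact: inL1_oo.
- apply/disj_setPS => x []; rewrite /= !in_itv /= => /andP[_ xc] /andP[].
  by rewrite ltNge xc.
Qed.

Lemma intg_chasles f c : inL1 f -> a <= c -> c <= b ->
  intg a b f = intg a c f + intg c b f.
Proof.
move=> hf; rewrite le_eqVlt => /predU1P[<- _|ac].
  by rewrite [intg a a f]intg_nil ?add0r.
rewrite le_eqVlt => /predU1P[->|cb].
  by rewrite [intg b b f]intg_nil ?addr0.
exact: intg_chasles_lt.
Qed.

End Bounds.

(** The quadratic polynomial t |-> int (f - t g) ^ 2 is nonnegative. *)
Lemma CauchySchwarz_intg a b f g : -1 <= a -> b <= 1 -> inL2 f -> inL2 g ->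
  intg a b (fun x => f x * g x) ^+ 2 <=
  intg a b (fun x => f x ^+ 2) * intg a b (fun x => g x ^+ 2).
Proof.
move=> a1 b1 hf hg.
set P := intg a b _; set F := intg a b _; set G := intg a b _.
have hF := inL2_sqr hf; have hG := inL2_sqr hg; have hP := inL2_mul hf hg.
have F0 : 0 <= F by apply: intg_ge0 => x _; exact: sqr_ge0.
have G0 : 0 <= G by apply: intg_ge0 => x _; exact: sqr_ge0.
have quad t : 0 <= F + (- 2 * t) * P + t ^+ 2 * G.
  have <- : intg a b (fun x => f x ^+ 2 + (- 2 * t) * (f x * g x)
      + t ^+ 2 * g x ^+ 2) = F + (- 2 * t) * P + t ^+ 2 * G.
    rewrite intgD//; [|by apply: inL1D => //; exact: inL1Z|exact: inL1Z].
    by rewrite intgD ?intgZ//; exact: inL1Z.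
  by apply: intg_ge0 => x _; have := sqr_ge0 (f x - t * g x); nra.
have [G00|Gn0] := eqVneq G 0.
  have := quad ((F + 1) / (2 * P)); rewrite G00 !mulr0 addr0.
  have [-> _|P0] := eqVneq P 0; first by rewrite expr0n.
  rewrite (_ : - 2 * _ * P = - (F + 1)); last by field.
  lra.
have := quad (P / G).
rewrite (_ : _ + _ = (F * G - P ^+ 2) / G); last by field.
rewrite pmulr_lge0 ?subr_ge0// invr_gt0; lra.
Qed.

(** This is H^1(-1, 1) with a weak derivative carried along: it is equivalent to
u being continuous on [-1, 1] with weak derivative g in L^2. *)
Definition primL2 u g : Prop :=
  [/\ {within Ic, continuous u}, inL2 g &
      forall a b, -1 <= a -> a <= b -> b <= 1 -> u b - u a = intg a b g].

Lemma primL2_holder u g a b : primL2 u g -> -1 <= a -> a <= b -> b <= 1 ->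
  (u b - u a) ^+ 2 <= (b - a) * intg a b (fun x => g x ^+ 2).
Proof.
move=> [_ hg ug] a1 ab b1; rewrite ug//.
have := CauchySchwarz_intg a1 b1 (inL2_cst 1) hg.
under eq_intg do rewrite mul1r.
under [X in _ <= X * _]eq_intg do rewrite expr1n.
by rewrite intg_cst ?mul1r.
Qed.

(** Cutting [x, y] into 2 ^ n pieces of equal length divides the factor y - x by
2 ^ n, while the increments of M still add up to M y - M x. This criterion avoids
differentiation almost everywhere in the proof of the product rule. *)
Lemma constant_by_halving (G M : R -> R) :
  (forall x y, -1 <= x -> x <= y -> y <= 1 ->
     `|G y - G x| <= (y - x) * (M y - M x)) ->
  forall x y, -1 <= x -> x <= y -> y <= 1 -> G y = G x.
Proof.
move=> hG.
have hn n x y : -1 <= x -> x <= y -> y <= 1 ->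
    `|G y - G x| * 2 ^+ n <= (y - x) * (M y - M x).
  elim: n x y => [|n IH] x y x1 xy y1; first by rewrite mulr1; exact: hG.
  pose z := (x + y) / 2.
  have xz : x <= z by rewrite /z; lra.
  have zy : z <= y by rewrite /z; lra.
  have h1 := IH _ _ x1 xz (le_trans zy y1).
  have h2 := IH _ _ (le_trans x1 xz) zy y1.
  have tri : `|G y - G x| <= `|G y - G z| + `|G z - G x|.
    by apply: le_trans (ler_normD _ _); rewrite addrA subrK.
  have p0 : 0 <= 2 ^+ n :> R by apply: exprn_ge0.
  have := ler_wpM2r p0 tri.
  rewrite exprS; move: h1 h2; rewrite /z; nra.
move=> x y x1 xy y1; apply/eqP; rewrite -subr_eq0 -normr_eq0.
have d0 := normr_ge0 (G y - G x); apply/negPn/negP => dn0.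
have dp : 0 < `|G y - G x| by rewrite lt_def dn0.
pose K := (y - x) * (M y - M x).
have K0 : 0 <= K / `|G y - G x|.
  by rewrite divr_ge0// /K; have := hn 0%N x y x1 xy y1; rewrite mulr1; lra.
have := archi_boundP K0; set n := Num.bound _.
rewrite ltr_pdivrMr// => hK.
have h1 := hn n x y x1 xy y1; rewrite -/K in h1.
have nn : n%:R <= 2 ^+ n :> R by rewrite -natrX ler_nat ltnW// ltn_expl.
have h2 := ler_wpM2l d0 nn.
move: h1 h2 hK; rewrite [n%:R * _]mulrC => h1 h2 hK; lra.
Qed.

Lemma primL2M_L1 u g w h : primL2 u g -> primL2 w h ->
  inL1 (fun x => g x * w x + u x * h x).
Proof.
move=> [cu hg _] [cw hh _]; apply: inL1D; apply: inL2_mul => //;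
  exact: wcont_L2.
Qed.

(** Over [x, y] the defect of the product rule is the integral of
g (w y - w) + h (u x - u). The increments of u and w are controlled by
[primL2_holder], and Young's inequality then bounds this integral by (y - x)
times the integral of g ^ 2 + h ^ 2, as [constant_by_halving] requires. *)
Lemma primL2M u g w h : primL2 u g -> primL2 w h ->
  primL2 (fun x => u x * w x) (fun x => g x * w x + u x * h x).
Proof.
move=> ACu ACw; have [cu hg ug] := ACu; have [cw hh wh] := ACw.
have hL1 := primL2M_L1 ACu ACw.
have hg2 := inL2_sqr hg; have hh2 := inL2_sqr hh.
split.
- exact: wcontM.
- apply: inL2D; last exact: inL2_bM.
  have := inL2_bM cw hg; congr inL2; apply/funext => x; exact: mulrC.
move=> a b a1 ab b1.
pose G t := u t * w t - intg (-1) t (fun x => g x * w x + u x * h x).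
pose M t := intg (-1) t (fun x => g x ^+ 2 + h x ^+ 2).
have N11 : -1 <= -1 :> R by [].
suff /(_ a b a1 ab b1) : forall x y, -1 <= x -> x <= y -> y <= 1 -> G y = G x.
  have b' := le_trans ab b1; have a' := le_trans a1 ab.
  by rewrite /G (@intg_chasles _ _ _ _ _ a)//; lra.
apply: (@constant_by_halving _ M) => x y x1 xy y1.
rewrite /M (@intg_chasles _ y _ _ _ x)//; last exact: inL1D.
rewrite [X in _ * X]addrC addKr.
have -> : G y - G x = intg x y (fun s => g s * (w y - w s) + h s * (u x - u s)).
  rewrite /G (@intg_chasles _ y _ _ _ x)//.
  under [RHS]eq_intg => s _.
    rewrite (_ : _ + _ = w y * g s + u x * h s - (g s * w s + u s * h s));
      last by ring.
    over.
  have hg1 := inL2_L1 hg; have hh1 := inL2_L1 hh.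
  rewrite intgB//; last by apply: inL1D; exact: inL1Z.
  have -> : intg x y (fun s => w y * g s + u x * h s) =
      w y * (u y - u x) + u x * (w y - w x).
    by rewrite intgD; [rewrite !intgZ// -wh// -ug|exact: x1|exact: y1|
      exact: inL1Z|exact: inL1Z].
  by ring.
have [->|xny] := eqVneq y x; first by rewrite !intg_nil// subrr mul0r normr0.
have yx : 0 < y - x by rewrite subr_gt0 lt_def xny.
set m := y - x in yx *.
pose B := intg x y (fun s => g s ^+ 2 + h s ^+ 2).
have hgx : intg x y (fun s => g s ^+ 2 + h s ^+ 2) =
  intg x y (fun s => g s ^+ 2) + intg x y (fun s => h s ^+ 2) by rewrite intgD.
have G20 : 0 <= intg x y (fun s => g s ^+ 2).
  by apply: intg_ge0 => s _; exact: sqr_ge0.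
have H20 : 0 <= intg x y (fun s => h s ^+ 2).
  by apply: intg_ge0 => s _; exact: sqr_ge0.
have sub_le k c d : inL2 k -> x <= c -> c <= d -> d <= y ->
    intg c d (fun s => k s ^+ 2) <= intg x y (fun s => k s ^+ 2).
  move=> /inL2_sqr hk xc cd dy.
  have h0 p q : 0 <= intg p q (fun s => k s ^+ 2).
    by apply: intg_ge0 => s _; exact: sqr_ge0.
  rewrite (@intg_chasles x y _ _ _ c)//; last exact: le_trans dy.
  rewrite (@intg_chasles c y _ _ _ d)//; last exact: le_trans xc.
  by have := h0 x c; have := h0 d y; lra.
apply: (@le_trans _ _ (intg x y
    (fun s => m / 2 * (g s ^+ 2 + h s ^+ 2) + B / 2))); last first.
  rewrite intgD//; last 2 first.
  - by apply: inL1Z; exact: inL1D.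
  - exact: inL1_cst.
  by rewrite (@intgZ x y x1 y1 _ (m / 2)) ?intg_cst//;
    [rewrite -/B -/m; lra|exact: inL1D].
have gws : inL1 (fun s => g s * (w y - w s)).
  apply: inL2_mul => //; apply: wcont_L2.
  by apply: wcontB => //; exact: wcont_cst.
have hus : inL1 (fun s => h s * (u x - u s)).
  apply: inL2_mul => //; apply: wcont_L2.
  by apply: wcontB => //; exact: wcont_cst.
apply: le_norm_intg => //; first exact: inL1D.
  by apply: inL1D; [apply: inL1Z; exact: inL1D|exact: inL1_cst].
move=> s /andP[/ltW xs /ltW sy].
have h1 : (w y - w s) ^+ 2 <= m * intg x y (fun s => h s ^+ 2).
  apply: le_trans (primL2_holder ACw _ sy _) _ => //; first exact: le_trans xs.
  apply: ler_pM; rewrite ?subr_ge0//.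
  - by apply: intg_ge0 => t _; exact: sqr_ge0.
  - by rewrite /m; lra.
  - exact: sub_le.
have h2 : (u x - u s) ^+ 2 <= m * intg x y (fun s => g s ^+ 2).
  rewrite -sqrrN opprB.
  apply: le_trans (primL2_holder ACu _ xs _) _ => //; first exact: le_trans sy _.
  apply: ler_pM; rewrite ?subr_ge0//.
  - by apply: intg_ge0 => t _; exact: sqr_ge0.
  - by rewrite /m; lra.
  - exact: sub_le.
(* Young's inequality in the form that uses the squared increment q. *)
have young (p q E : R) : q ^+ 2 <= m * E ->
  `|p * q| <= m / 2 * p ^+ 2 + E / 2.
  move=> qE.
  have q2 : `|q| ^+ 2 = q ^+ 2 by rewrite real_normK ?num_real.
  have n0 := normr_ge0 p; have q0 := normr_ge0 q.
  rewrite normrM -(ler_pM2l yx).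
  have p2 : `|p| ^+ 2 = p ^+ 2 by rewrite real_normK ?num_real.
  have : 0 <= (m * `|p| - `|q|) ^+ 2 by exact: sqr_ge0.
  nra.
apply: le_trans (ler_normD _ _) _.
have y1' := young (g s) _ _ h1.
have y2' := young (h s) _ _ h2.
by rewrite /B hgx; lra.
Qed.

Lemma primL2_ext u g v h : (forall x, -1 <= x <= 1 -> u x = v x) ->
  (forall x, -1 < x < 1 -> g x = h x) -> measurable_fun Io h ->
  primL2 u g -> primL2 v h.
Proof.
move=> uv gh mh [cu [mg hg] ug]; split.
- apply: subspace_eq_continuous cu => x; rewrite inE /Iclosed /= in_itv /=.
  exact: uv.
- split => //; apply: inL1_ext hg => x; rewrite /Iopen /= in_itv /= => Ix.
  by rewrite gh.
- move=> a b a1 ab b1; rewrite -!uv ?ug//; last 2 first.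
  - by rewrite a1 (le_trans ab).
  - by rewrite b1 (le_trans a1).
  apply: eq_intg => x /andP[ax xb]; apply: gh.
  by rewrite (le_lt_trans a1 ax) (lt_le_trans xb b1).
Qed.

Lemma primL2D u g v h : primL2 u g -> primL2 v h ->
  primL2 (fun x => u x + v x) (fun x => g x + h x).
Proof.
move=> [cu hg ug] [cv hh vh]; split; [exact: wcontD|exact: inL2D|].
move=> a b a1 ab b1; rewrite intgD//; try exact: inL2_L1.
by rewrite -ug// -vh//; ring.
Qed.

Lemma primL2Z u g r : primL2 u g ->
  primL2 (fun x => r * u x) (fun x => r * g x).
Proof.
move=> [cu hg ug]; split; [exact: wcontZ|exact: inL2Z|].
move=> a b a1 ab b1; rewrite intgZ//; last exact: inL2_L1.
by rewrite -ug// mulrBr.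
Qed.

Lemma primL2B u g v h : primL2 u g -> primL2 v h ->
  primL2 (fun x => u x - v x) (fun x => g x - h x).
Proof.
move=> [cu hg ug] [cv hh vh]; split; [exact: wcontB|exact: inL2B|].
move=> a b a1 ab b1; rewrite intgB//; try exact: inL2_L1.
by rewrite -ug// -vh//; ring.
Qed.

Lemma primL2_cst r : primL2 (fun=> r) (fun=> 0).
Proof.
split; [exact: wcont_cst|exact: inL2_cst|].
by move=> a b a1 ab b1; rewrite intg_cst// mul0r subrr.
Qed.

Lemma primL2_C1 f g : (forall x : R, -1 <= x <= 1 -> is_derive x 1 f (g x)) ->
  {within Ic, continuous g} -> primL2 f g.
Proof.
move=> fg cg.
have cf x : -1 <= x <= 1 -> {for x, continuous f}.
  move=> hx; have := fg x hx => dfx.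
  by apply: differentiable_continuous; apply/derivable1_diffP; case: dfx.
split.
- apply: continuous_in_subspaceT => x; rewrite inE /Iclosed /= in_itv /=.
  exact: cf.
- exact: wcont_L2.
move=> a b a1; rewrite le_eqVlt => /predU1P[-> _|ab b1].
  by rewrite intg_nil// subrr.
have sub x : a <= x <= b -> -1 <= x <= 1.
  by move=> /andP[ax xb]; rewrite (le_trans a1 ax) (le_trans xb b1).
have cgab : {within `[a, b], continuous g}.
  apply: continuous_subspaceW cg => x; rewrite /Iclosed /= !in_itv /=.
  exact: sub.
have := @continuous_FTC2 R g f a b ab cgab.
rewrite /intg Rintegral_itv_bndo_bndc; last first.
  by apply: inL1_oo => //; exact: wcont_L1.
rewrite Rintegral_itv_obnd_cbnd; last first.
  apply: integrableS (continuous_compact_integrable _ cgab).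
  - exact: measurable_itv.
  - exact: measurable_itv.
  - by move=> x; rewrite /= !in_itv /= => /andP[/ltW -> ->].
  - exact: segment_compact.
rewrite /Rintegral => ->//.
- split.
  + move=> x; rewrite in_itv /= => /andP[/ltW ax /ltW xb].
    by have := fg x (sub x _); rewrite ax xb => /(_ isT) [].
  + apply: cvg_at_right_filter; apply: cf; apply: sub; rewrite lexx ltW//.
  + apply: cvg_at_left_filter; apply: cf; apply: sub; rewrite lexx ltW//.
- move=> x; rewrite in_itv /= => /andP[/ltW ax /ltW xb].
  have := fg x (sub x _); rewrite ax xb => /(_ isT) h.
  by rewrite derive1E; apply: derive_val.
Qed.

End Primitives.

(** * Test functions *)

Section TestFunctions.
Context {R : realType}.
Implicit Types (u v f g : R -> R) (a b c r e x : R).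
Local Notation Ic := (@Iclosed R).

Lemma intg_support f a b : -1 <= a -> a <= b -> b <= 1 -> inL1 f ->
  (forall x, x < a \/ b < x -> f x = 0) -> intg (-1) 1 f = intg a b f.
Proof.
move=> a1 ab b1 hf f0; have a1' := le_trans ab b1.
rewrite (@intg_chasles _ _ _ _ _ _ a)// (@intg_chasles _ a _ _ _ _ b)//.
rewrite (@eq_intg _ (-1) a _ (fun=> 0)); last first.
  by move=> x /andP[_ xa]; apply: f0; left.
rewrite (@eq_intg _ b 1 _ (fun=> 0)); last first.
  by move=> x /andP[xb _]; apply: f0; right.
by rewrite !intg_cst// ?(le_trans a1)// !mul0r add0r addr0.
Qed.

Lemma is_derive_quadratic (f : R -> R) (x d C : R) :
  (forall h : R, `|f (h + x) - f x - h * d| <= C * h ^+ 2) -> is_derive x 1 f d.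
Proof.
move=> hf; have C0 : 0 <= C.
  by have := le_trans (normr_ge0 _) (hf 1); rewrite expr1n mulr1.
have cvgd : h^-1 *: (f (h *: 1 + x) - f x) @[h --> (0 : R)^'] --> d.
  apply/cvgrPdist_le => eps e0; near=> h.
  have h0 : h != 0 by near: h; exact: nbhs_dnbhs_neq.
  have -> : d - h^-1 *: (f (h *: 1 + x) - f x) =
      - (h^-1 * (f (h + x) - f x - h * d)).
    by rewrite /GRing.scale /= mulr1; field.
  rewrite normrN normrM normfV ler_pdivrMl ?normr_gt0//.
  apply: le_trans (hf h) _; rewrite -[h ^+ 2]real_normK ?num_real//.
  rewrite expr2 mulrCA ler_pM2l ?normr_gt0//.
  have : `|h| <= eps / (C + 1).
    by near: h; apply: dnbhs0_le; rewrite divr_gt0// ltr_wpDl.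
  rewrite ler_pdivlMr ?ltr_wpDl//.
  have := normr_ge0 h; lra.
apply: DeriveDef; first by apply/cvg_ex; exists d.
exact/cvg_lim.
Unshelve. all: by end_near. Qed.

Definition pospart (t : R) : R := Num.max 0 t.

Lemma pospartP t : (t <= 0 /\ pospart t = 0) \/ (0 <= t /\ pospart t = t).
Proof.
have [t0|t0] := leP t 0; [left|right]; rewrite /pospart; split => //.
- by rewrite max_l.
- exact: ltW.
- by rewrite max_r ?ltW.
Qed.

Lemma pospart_continuous : continuous pospart.
Proof.
move=> x; apply: (@continuous_max _ _ (cst 0) id x); [exact: cst_continuous|].
exact: cvg_id.
Qed.

(** A spline of class C^1 that rises from 0 to 1 on [a, a + 2e]: squares of
positive parts are C^1, and the weights 1, -2, 1 cancel the terms of degree two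
and one beyond a + 2e. *)
Definition ramp (a e x : R) : R :=
  (pospart (x - a) ^+ 2 - 2 * pospart (x - a - e) ^+ 2
   + pospart (x - a - 2 * e) ^+ 2) / (2 * e ^+ 2).

Definition tent (a e x : R) : R :=
  (pospart (x - a) - 2 * pospart (x - a - e) + pospart (x - a - 2 * e)) / e ^+ 2.

Lemma ramp_derive a e x : 0 < e -> is_derive x 1 (ramp a e) (tent a e x).
Proof.
move=> e0.
have q (t h : R) : `|pospart (h + t) ^+ 2 - pospart t ^+ 2 - 2 * h * pospart t|
    <= h ^+ 2.
  by case: (pospartP t) => -[? ->]; case: (pospartP (h + t)) => -[? ->];
    rewrite ler_norml; apply/andP; split; nra.
apply: (@is_derive_quadratic _ _ _ (2 / e ^+ 2)) => h.
have q1 := q (x - a) h; have q2 := q (x - a - e) h.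
have q3 := q (x - a - 2 * e) h.
have -> : ramp a e (h + x) - ramp a e x - h * tent a e x =
  ((pospart (h + (x - a)) ^+ 2 - pospart (x - a) ^+ 2 - 2 * h * pospart (x - a))
  - 2 * (pospart (h + (x - a - e)) ^+ 2 - pospart (x - a - e) ^+ 2
         - 2 * h * pospart (x - a - e))
  + (pospart (h + (x - a - 2 * e)) ^+ 2 - pospart (x - a - 2 * e) ^+ 2
         - 2 * h * pospart (x - a - 2 * e))) / (2 * e ^+ 2).
  rewrite /ramp /tent !addrA; field; lra.
have tri (A B D k : R) : `|A| <= k -> `|B| <= k -> `|D| <= k ->
    `|A - 2 * B + D| <= 4 * k.
  rewrite !ler_norml => /andP[? ?] /andP[? ?] /andP[? ?].
  by apply/andP; split; lra.
rewrite normrM (@ger0_norm _ (_^-1)); last first.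
  by rewrite invr_ge0 mulr_ge0 ?sqr_ge0.
rewrite ler_pdivrMr; last by rewrite mulr_gt0 ?exprn_gt0.
have -> : 2 / e ^+ 2 * h ^+ 2 * (2 * e ^+ 2) = 4 * h ^+ 2 by field; lra.
exact: tri.
Qed.

Lemma tent_continuous a e : continuous (tent a e).
Proof.
have c r : continuous (fun x => pospart (x - r)).
  move=> x; apply: (@continuous_comp _ _ _ (fun x => x - r) pospart).
    by apply: cvgB; [exact: cvg_id|exact: cvg_cst].
  exact: pospart_continuous.
have cc r s : continuous (fun x => pospart (x - r - s)).
  have := c (r + s); rewrite (_ : (fun x => _) = fun x => pospart (x - r - s))//.
  by apply/funext => x; rewrite opprD addrA.
move=> x; apply: cvgM; last exact: cvg_cst.
apply: cvgD; last exact: cc.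
apply: cvgB; first exact: c.
by apply: cvgM; [exact: cvg_cst|exact: cc].
Qed.

Lemma ramp_left a e x : 0 < e -> x <= a -> ramp a e x = 0.
Proof.
move=> e0 xa.
have p0 t : t <= 0 -> pospart t = 0 by case: (pospartP t) => -[? ->] //; lra.
by rewrite /ramp !p0; [rewrite expr0n mulr0 subrr addr0 mul0r|lra..].
Qed.

Lemma ramp_right a e x : 0 < e -> a + 2 * e <= x -> ramp a e x = 1.
Proof.
move=> e0 xa; rewrite /ramp.
case: (pospartP (x - a)) => -[? ->]; first lra.
case: (pospartP (x - a - e)) => -[? ->]; first lra.
case: (pospartP (x - a - 2 * e)) => -[? ->]; last by field; lra.
have -> : x - a = 2 * e by lra.
by field; lra.
Qed.

Lemma tent_ge0 a e x : 0 < e -> 0 <= tent a e x.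
Proof.
move=> e0; apply: divr_ge0; last exact: sqr_ge0.
by case: (pospartP (x - a)) => -[? ->]; case: (pospartP (x - a - e)) => -[? ->];
  case: (pospartP (x - a - 2 * e)) => -[? ->]; lra.
Qed.

Lemma tent_out a e x : 0 < e -> x <= a \/ a + 2 * e <= x -> tent a e x = 0.
Proof.
move=> e0 H; rewrite /tent.
apply/eqP; rewrite mulf_eq0; apply/orP; left; apply/eqP.
by case: H => H;
  case: (pospartP (x - a)) => -[? ->]; case: (pospartP (x - a - e)) => -[? ->];
  case: (pospartP (x - a - 2 * e)) => -[? ->]; lra.
Qed.

Lemma continuous_wcont u : continuous u -> {within Ic, continuous u}.
Proof. by move=> cu; apply: continuous_subspaceT. Qed.

Lemma ramp_primL2 a e : 0 < e -> primL2 (ramp a e) (tent a e).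
Proof.
move=> e0; apply: primL2_C1 => [x _|]; first exact: ramp_derive.
exact/continuous_wcont/tent_continuous.
Qed.

Lemma ramp_itv a e x : 0 < e -> 0 <= ramp a e x <= 1.
Proof.
move=> e0; apply/andP; split; last rewrite ler_pdivrMr ?mulr_gt0 ?exprn_gt0//.
  apply: divr_ge0; last by rewrite mulr_ge0 ?sqr_ge0.
  by case: (pospartP (x - a)) => -[? ->];
    case: (pospartP (x - a - e)) => -[? ->];
    case: (pospartP (x - a - 2 * e)) => -[? ->]; nra.
by case: (pospartP (x - a)) => -[? ->];
  case: (pospartP (x - a - e)) => -[? ->];
  case: (pospartP (x - a - 2 * e)) => -[? ->]; nra.
Qed.

End TestFunctions.

(** * Weak derivatives *)

Section WeakDerivatives.
Context {R : realType}.
Implicit Types (u v f g : R -> R) (a b c r e x : R).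
Local Notation mu := (@lebesgue_measure R).
Local Notation Io := (@Iopen R).
Local Notation Ic := (@Iclosed R).

(** Equal to 1 on [a + 3e, b - 3e] and supported in [a + e, b - e], so that it is a
test function on ]-1, 1[ even when a = -1 or b = 1. *)
Definition plateau a b e x : R := ramp (a + e) e x - ramp (b - 3 * e) e x.

Definition dplateau a b e x : R := tent (a + e) e x - tent (b - 3 * e) e x.

Lemma plateau_derive a b e x : 0 < e ->
  is_derive x 1 (plateau a b e) (dplateau a b e x).
Proof. by move=> e0; apply: is_deriveB; exact: ramp_derive. Qed.

Lemma plateau_out a b e x : 0 < e -> a + 8 * e <= b ->
  x <= a + e \/ b - e <= x -> plateau a b e x = 0.
Proof.
move=> e0 ab [xa|bx]; rewrite /plateau.
  by rewrite !ramp_left ?subrr//; lra.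
by rewrite !ramp_right ?subrr//; lra.
Qed.

Lemma plateau_test a b e : -1 <= a -> b <= 1 -> 0 < e -> a + 8 * e <= b ->
  test_function (plateau a b e).
Proof.
move=> a1 b1 e0 ab; split.
- by move=> x; have [] := plateau_derive a b x e0.
- rewrite (_ : derive1 _ = dplateau a b e).
    by move=> x; apply: cvgB; exact: tent_continuous.
  apply/funext => x; rewrite derive1E.
  have h := plateau_derive a b x e0; exact: derive_val.
- apply: (@subset_trans _ `[a + e, b - e]).
    rewrite closureE; apply: smallest_sub.
      exact: itv_closed.
    move=> x /= /eqP px; rewrite in_itv /=.
    apply/andP; split; rewrite leNgt; apply/negP => hx; apply: px;
      apply: plateau_out => //; [left|right]; exact: ltW.
  move=> x; rewrite /Iopen /= !in_itv /= => /andP[? ?].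
  by apply/andP; split; lra.
Qed.

Lemma wcont_at u a (eps : R) : {within Ic, continuous u} -> -1 <= a <= 1 ->
  0 < eps -> exists2 d : R, 0 < d &
    forall x, -1 <= x <= 1 -> `|a - x| < d -> `|u x - u a| <= eps.
Proof.
move=> /subspace_continuousP cu ha e0.
have Ia : Ic a by rewrite /Iclosed /= in_itv.
have /cvgrPdist_le /(_ _ e0) := cu a Ia.
rewrite /prop_near1 /within /= => -[d /= d0 hd]; exists d => // x hx ax.
by rewrite distrC; apply: hd => //; rewrite /Iclosed /= in_itv.
Qed.

(** Testing with a plateau over [a, b] of small e turns the left-hand side of the
weak formulation into the difference of two averages of u, near a and near b,
and the right-hand side into the integral of g up to an error of square at most
6 e int g ^ 2. *)
Lemma weak_derivative_primL2 u g : {within Ic, continuous u} -> inL2 g ->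
  weak_derivative u g -> primL2 u g.
Proof.
move=> cu hg wg; split => // a b a1; rewrite le_eqVlt => /predU1P[-> _|ab b1].
  by rewrite intg_nil// subrr.
apply/eqP; rewrite -subr_eq0 -normr_le0; apply/ler_addgt0Pl => /= eta3 eta30.
rewrite addr0; pose eta : R := eta3 / 3.
have eta0 : 0 < eta by rewrite divr_gt0.
have ha : -1 <= a <= 1 by rewrite a1 (le_trans (ltW ab)).
have hb : -1 <= b <= 1 by rewrite b1 (le_trans a1 (ltW ab)).
have [da da0 hda] := wcont_at cu ha eta0.
have [db db0 hdb] := wcont_at cu hb eta0.
pose M := intg a b (fun x => g x ^+ 2).
have M0 : 0 <= M by apply: intg_ge0 => x _; exact: sqr_ge0.
(* The plateau is steep only within 3e of a and of b. *)
have [e [e0 eab eda edb eM]] : exists e : R, [/\ 0 < e, a + 8 * e <= b,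
    3 * e < da, 3 * e < db & 6 * e * M <= eta ^+ 2].
  pose e : R := Num.min (Num.min ((b - a) / 8) (eta ^+ 2 / (6 * (M + 1))))
                    (Num.min (da / 4) (db / 4)).
  have e0 : 0 < e.
    by rewrite !lt_min !divr_gt0 ?subr_gt0 ?exprn_gt0 ?mulr_gt0 ?ltr_wpDl.
  have : e <= e by [].
  rewrite {2}/e !le_min => /andP[/andP[e1 e2] /andP[e3 e4]].
  exists e; split => //; try lra.
  move: e2; rewrite ler_pdivlMr ?mulr_gt0 ?ltr_wpDl//; nra.
pose t1 := tent (a + e) e; pose t2 := tent (b - 3 * e) e.
pose phi := plateau a b e.
have ct1 : {within Ic, continuous t1} by exact/continuous_wcont/tent_continuous.
have ct2 : {within Ic, continuous t2} by exact/continuous_wcont/tent_continuous.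
have [cr1 _ r1] := ramp_primL2 (a + e) e0.
have [cr2 _ r2] := ramp_primL2 (b - 3 * e) e0.
have cphi : {within Ic, continuous phi} by exact: wcontB.
have dphi x : derive1 phi x = t1 x - t2 x.
  by rewrite derive1E; have h := plateau_derive a b x e0; exact: derive_val.
have := wg _ (plateau_test a1 b1 e0 eab).
rewrite (_ : Rintegral mu Iopen _ =
   intg (-1) 1 (fun x => u x * t1 x - u x * t2 x)); last first.
  by apply: eq_intg => x _; rewrite dphi mulrBr.
rewrite (_ : Rintegral mu Iopen _ = intg (-1) 1 (fun x => g x * phi x))//.
have ut1 : inL1 (fun x => u x * t1 x) by apply: wcont_L1; exact: wcontM.
have ut2 : inL1 (fun x => u x * t2 x) by apply: wcont_L1; exact: wcontM.
have gphi : inL1 (fun x => g x * phi x).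
  by apply: inL2_mul => //; exact: wcont_L2.
have N11 : -1 <= -1 :> R by []. have P11 : 1 <= 1 :> R by [].
rewrite (@intg_support _ _ a b)//; [|exact: ltW|exact: inL1B|]; last first.
  by move=> x hx; rewrite /t1 /t2 !tent_out ?mulr0 ?subrr//; lra.
rewrite (@intg_support _ _ a b)//; [|exact: ltW|]; last first.
  by move=> x hx; rewrite /phi plateau_out ?mulr0//; lra.
rewrite intgB// => weak.
(* The weights [tent] have integral 1, so they average values of u near r. *)
have ave (t : R -> R) (r : R) : {within Ic, continuous t} ->
    (forall x, 0 <= t x) ->
    intg a b t = 1 ->
    (forall x, a < x < b -> t x = 0 \/ `|u x - r| <= eta) ->
    `|intg a b (fun x => u x * t x) - r| <= eta.
  move=> ct t0 it near_r.
  have -> : intg a b (fun x => u x * t x) - r =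
      intg a b (fun x => (u x - r) * t x).
    under [RHS]eq_intg do rewrite mulrBl.
    rewrite intgB ?intgZ ?it ?mulr1//; try exact: wcont_L1.
      by apply: wcont_L1; exact: wcontM.
    by apply: wcont_L1; exact: wcontZ.
  have -> : eta = intg a b (fun x => eta * t x).
    by rewrite intgZ ?it ?mulr1//; exact: wcont_L1.
  apply: le_norm_intg => //.
  - apply: wcont_L1; apply: wcontM => //; apply: wcontB => //.
    exact: wcont_cst.
  - by apply: wcont_L1; exact: wcontZ.
  - move=> x xab; case: (near_r x xab) => [->|ux]; first by rewrite !mulr0 normr0.
    by rewrite normrM [X in _ * X]ger0_norm// ler_wpM2r.
have A1 : `|intg a b (fun x => u x * t1 x) - u a| <= eta.
  apply: ave => //; first by move=> x; exact: tent_ge0.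
  - rewrite -(r1 a b a1 (ltW ab) b1) ramp_right ?ramp_left ?subr0//; lra.
  - move=> x /andP[ax xb]; have [xe|xe] := leP (a + 3 * e) x.
      by left; apply: tent_out => //; lra.
    right; apply: hda; first by lra.
    by rewrite ler0_norm; lra.
have A2 : `|intg a b (fun x => u x * t2 x) - u b| <= eta.
  apply: ave => //; first by move=> x; exact: tent_ge0.
  - rewrite -(r2 a b a1 (ltW ab) b1) ramp_right ?ramp_left ?subr0//; lra.
  - move=> x /andP[ax xb]; have [xe|xe] := leP x (b - 3 * e).
      by left; apply: tent_out => //; lra.
    right; apply: hdb; first by lra.
    by rewrite ger0_norm; lra.
have cphi' : {within Ic, continuous (fun x => 1 - phi x)}.
  by apply: wcontB => //; exact: wcont_cst.
have A3 : `|intg a b g - intg a b (fun x => g x * phi x)| <= eta.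
  rewrite -intgB//; last exact: inL2_L1.
  under eq_intg do rewrite -{1}[g _]mulr1 -mulrBr.
  rewrite -(@ler_pXn2r _ 2) ?nnegrE ?normr_ge0 ?(ltW eta0)//.
  rewrite real_normK ?num_real//.
  apply: le_trans (CauchySchwarz_intg a1 b1 hg (wcont_L2 cphi')) _.
  apply: le_trans eM; rewrite mulrC ler_wpM2r//.
  have i1 : inL1 (fun x => 1 - ramp (a + e) e x).
    by apply: inL1B; [exact: inL1_cst|exact: wcont_L1].
  have i2 : inL1 (ramp (b - 3 * e) e) by exact: wcont_L1.
  apply: (@le_trans _ _ (intg a b (fun x => (1 - ramp (a + e) e x)
      + ramp (b - 3 * e) e x))).
    apply: intg_le => //; [by apply: wcont_L1; exact: wcontX|exact: inL1D|].
    move=> x _; rewrite /phi /plateau.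
    have := ramp_itv (a + e) x e0; have := ramp_itv (b - 3 * e) x e0.
    have [xe|xe] := leP (a + 3 * e) x.
      rewrite (@ramp_right _ (a + e)) ?subrr//; last lra.
      move=> /andP[? ?] _; nra.
    rewrite (@ramp_left _ (b - 3 * e)) ?subrr//; last lra.
    move=> _ /andP[? ?]; nra.
  rewrite intgD//.
  rewrite (@intg_chasles _ a b _ _ _ (a + 3 * e)) => //; [|lra|lra].
  rewrite [X in _ + X](@intg_chasles _ a b _ _ _ (b - 3 * e)) => //; [|lra|lra].
  rewrite [X in _ + X + _](@eq_intg _ _ _ _ (fun=> 0)); last first.
    by move=> x /andP[xe _]; rewrite ramp_right ?subrr//; lra.
  rewrite [X in _ + (X + _)](@eq_intg _ _ _ _ (fun=> 0)); last first.
    by move=> x /andP[_ xe]; rewrite ramp_left//; lra.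
  rewrite !intg_cst ?mul0r ?addr0 ?add0r; [|lra..].
  have B1 : intg a (a + 3 * e) (fun x => 1 - ramp (a + e) e x) <=
      intg a (a + 3 * e) (fun=> 1).
    apply: intg_le => //; [lra|exact: inL1_cst|].
    by move=> x _; have := ramp_itv (a + e) x e0; lra.
  have B2 : intg (b - 3 * e) b (ramp (b - 3 * e) e) <=
      intg (b - 3 * e) b (fun=> 1).
    apply: intg_le => //; [lra|exact: inL1_cst|].
    by move=> x _; have := ramp_itv (b - 3 * e) x e0; lra.
  rewrite intg_cst in B1; [|lra..]. rewrite intg_cst in B2; [|lra..].
  lra.
rewrite (_ : u b - u a - intg a b g =
  (intg a b (fun x => u x * t1 x) - u a)
  - (intg a b (fun x => u x * t2 x) - u b)
  - (intg a b g - intg a b (fun x => g x * phi x))); last by move: weak; lra.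
rewrite (_ : eta3 = eta + eta + eta); last by rewrite /eta; field.
by apply: le_trans (ler_normB _ _) _; apply: lerD => //;
  apply: le_trans (ler_normB _ _) _; apply: lerD.
Qed.

(** The product of u with a test function vanishes at both ends. *)
Lemma primL2_weak_derivative u g : primL2 u g -> weak_derivative u g.
Proof.
move=> ACu phi [dphi cphi supp].
have phi_AC : primL2 phi (derive1 phi).
  apply: primL2_C1; last exact: continuous_wcont.
  by move=> x _; rewrite derive1E; apply: derivableP.
have phi0 x : ~ Io x -> phi x = 0.
  move=> Ix; apply/eqP/negPn/negP => px; apply: Ix; apply: supp.
  exact: subset_closure.
have phi1 : phi 1 = 0.
  by apply: phi0; rewrite /Iopen /= in_itv /= ltxx andbF.
have phiN1 : phi (-1) = 0.
  by apply: phi0; rewrite /Iopen /= in_itv /= ltxx.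
have [_ _ /(_ (-1) 1)] := primL2M ACu phi_AC.
have [cu hg _] := ACu; have [cp hp _] := phi_AC.
have N11 : -1 <= 1 :> R by lra.
rewrite phi1 phiN1 !mulr0 subrr intgD// => [/(_ (lexx _) N11 (lexx _)) e0||].
- by apply/eqP; rewrite -addr_eq0 addrC; apply/eqP; exact/esym/e0.
- by apply: inL2_mul => //; exact: wcont_L2.
- by apply: inL2_mul => //; exact: wcont_L2.
Qed.

End WeakDerivatives.

Section Uniqueness.
Context {R : realType}.
Implicit Types (u v f g : R -> R) (a b c r e x : R).
Local Notation mu := (@lebesgue_measure R).
Local Notation Io := (@Iopen R).

(** The primitive of g1 - g2 is constant, and by Lebesgue's differentiation theorem
it has derivative g1 - g2 almost everywhere. *)
Lemma density_unique u g1 g2 : primL2 u g1 -> primL2 u g2 ->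
  {ae mu, forall x, Io x -> g1 x = g2 x}.
Proof.
move=> [_ hg1 ug1] [_ hg2 ug2].
pose d x := g1 x - g2 x.
have hd : inL1 d by apply: inL2_L1; exact: inL2B.
have d0 a b : -1 <= a -> a <= b -> b <= 1 -> intg a b d = 0.
  move=> a1 ab b1; rewrite intgB//; [|exact: inL2_L1..].
  by rewrite -ug1// -ug2// subrr.
pose f := d \_ Io.
have fT : mu.-integrable setT (EFin \o f).
  have := hd; rewrite /inL1 integrable_mkcond; last exact: Iopen_measurable.
  by rewrite restrict_EFin.
have locf := integrable_locally (@Iopen_measurable R) hd.
have fitv y : mu.-integrable [set` Interval (BLeft (-1)) (BRight y)] (EFin \o f).
  by apply: integrableS fT => //; exact: measurable_itv.
have := FTC1 fitv locf.
apply: filterS; first exact: (ae_filter_ringOfSetsType mu).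
move=> x hx Ix.
have /andP[x1 x2] : -1 < x < 1 by move: Ix; rewrite /Iopen /= in_itv.
have [|_] := hx; first by rewrite lte_fin.
rewrite /f patchE mem_set// derive1E (_ : 'D_1 _ x = 0) => [d0x|].
  by apply/eqP; rewrite -subr_eq0 -/(d x) -d0x.
rewrite -(@derive_cst R R R 0 x 1); apply: near_eq_derive.
near=> y.
have /andP[y1 y2] : -1 < y < 1.
  near: y; have := @near_in_itvoo R (-1) 1 x.
  by rewrite in_itv /= x1 x2 => /(_ isT); apply: filterS => z; rewrite in_itv.
transitivity (intg (-1) y d); last first.
  by rewrite d0; [|exact: lexx|exact: ltW|exact: ltW].
have dy : mu.-integrable `]-1, y[ (EFin \o d).
  by apply: inL1_oo => //; exact: ltW.
have fy : mu.-integrable `]-1, y] (EFin \o f).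
  by apply: integrableS fT => //; exact: measurable_itv.
rewrite /intg (Rintegral_itv_bndo_bndc dy) -(Rintegral_itv_obnd_cbnd fy).
apply: eq_Rintegral => z; rewrite inE /= in_itv /= => /andP[z1 zy].
by rewrite /f patchE mem_set// /Iopen /= in_itv /= z1 (le_lt_trans zy).
Unshelve. all: by end_near. Qed.

Lemma primL2_inH1 u g : primL2 u g -> inH1 u.
Proof.
move=> ACu; have [cu hg _] := ACu; split => //; first exact: wcont_L2.
by exists g; split => //; exact: primL2_weak_derivative.
Qed.

Lemma inH1_primL2 u : inH1 u -> primL2 u (wderiv u).
Proof.
by move=> [cu _ /(@getPex (R -> R))[hg wg]]; exact: weak_derivative_primL2.
Qed.

Lemma wderiv_ae u g : primL2 u g -> {ae mu, forall x, Io x -> wderiv u x = g x}.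
Proof.
move=> ACu; apply: density_unique (ACu).
by apply: inH1_primL2; exact: primL2_inH1 ACu.
Qed.

End Uniqueness.

(** * Tensors in block form *)

Section Tensors.
Context {R : realType}.
Implicit Types (u v f g : R -> R) (a b c r e x : R).
Local Notation mu := (@lebesgue_measure R).
Local Notation Io := (@Iopen R).
Local Notation Ic := (@Iclosed R).

(** The bulk density of a tensor of the block form, in terms of a = q1 and
m = q2 ^ 2 + q3 ^ 2. *)
Definition potential theta c a m : R :=
  theta / 6 * (6 * a ^+ 2 + 2 * m) + 4 * a ^+ 3 - 4 * a * m
  + 1 / 8 * (6 * a ^+ 2 + 2 * m) ^+ 2 + c.

Lemma ord3_ind (P : 'I_3 -> Prop) :
  P ord0 -> P (lift ord0 ord0) -> P (lift ord0 (lift ord0 ord0)) -> forall i, P i.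
Proof.
move=> P0 P1 P2 i; case: (unliftP ord0 i) => [j ->|->] //.
case: (unliftP ord0 j) => [k ->|->] //.
by case: (unliftP ord0 k) => [[]//|->].
Qed.

Lemma normsqE (A : 'M[R]_3) : normsq A = \sum_i \sum_j A i j * A j i.
Proof. by apply: eq_bigr => i _; rewrite mxE. Qed.

Lemma normsq_Qmat (t : triple R) x :
  normsq (Qmat t x) = 6 * q1 t x ^+ 2 + 2 * q2 t x ^+ 2 + 2 * q3 t x ^+ 2.
Proof.
rewrite normsqE !big_ord_recl !big_ord0 !mxE /=; ring.
Qed.

Lemma bulk_Qmat theta c (t : triple R) x :
  bulk theta c (Qmat t x) =
  potential theta c (q1 t x) (q2 t x ^+ 2 + q3 t x ^+ 2).
Proof.
rewrite /bulk normsq_Qmat /potential.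
have -> : \tr (Qmat t x *m Qmat t x *m Qmat t x) =
  - 6 * q1 t x ^+ 3 + 6 * q1 t x * (q2 t x ^+ 2 + q3 t x ^+ 2).
  rewrite /mxtrace !big_ord_recl !big_ord0 !(mxE, big_ord_recl, big_ord0) /=.
  ring.
by field.
Qed.

Lemma Qmat_sym_traceless (t : triple R) x : sym_traceless (Qmat t x).
Proof.
split; first by apply/matrixP; do 2 apply: ord3_ind; rewrite !mxE.
by rewrite /mxtrace !big_ord_recl !big_ord0 !mxE /=; ring.
Qed.

Lemma primL2_Qmat (q g : triple R) i j : primL2 (q1 q) (q1 g) ->
  primL2 (q2 q) (q2 g) -> primL2 (q3 q) (q3 g) ->
  primL2 (fun y => Qmat q y i j) (fun y => Qmat g y i j).
Proof.
move=> h1 h2 h3.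
have e u v w z : (forall y, v y = u y) -> (forall y, z y = w y) ->
    primL2 u w -> primL2 v z.
  by move=> /funext -> /funext ->.
have h0 := primL2_cst (0 : R).
move: j i; apply: ord3_ind; apply: ord3_ind.
- by apply: e (primL2Z (- 2) h1) => y; rewrite mxE.
- by apply: e h0 => y; rewrite mxE.
- by apply: e h0 => y; rewrite mxE.
- by apply: e h0 => y; rewrite mxE.
- by apply: e (primL2B h1 h2) => y; rewrite mxE.
- by apply: e h3 => y; rewrite mxE.
- by apply: e h0 => y; rewrite mxE.
- by apply: e h3 => y; rewrite mxE.
- by apply: e (primL2D h1 h2) => y; rewrite mxE.
Qed.

Lemma wderivmx_ae (q g : triple R) : primL2 (q1 q) (q1 g) ->
  primL2 (q2 q) (q2 g) -> primL2 (q3 q) (q3 g) ->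
  {ae mu, forall x, Io x -> wderivmx (Qmat q) x = Qmat g x}.
Proof.
move=> h1 h2 h3.
have F := ae_filter_ringOfSetsType mu.
have : {ae mu, forall x (ij : 'I_3 * 'I_3), Io x ->
    wderiv (fun y => Qmat q y ij.1 ij.2) x = Qmat g x ij.1 ij.2}.
  apply: filter_forall => -[i j] /=.
  by apply: wderiv_ae; exact: primL2_Qmat.
apply: filterS => x hx Ix; apply/matrixP => i j.
by rewrite mxE; exact: (hx (i, j)).
Qed.

Lemma measurable_normsq_wderivmx (q g : triple R) : primL2 (q1 q) (q1 g) ->
  primL2 (q2 q) (q2 g) -> primL2 (q3 q) (q3 g) ->
  measurable_fun Io (fun x => normsq (wderivmx (Qmat q) x)).
Proof.
move=> h1 h2 h3.
rewrite (_ : (fun x => _) = fun x => \sum_i \sum_j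
  (wderiv (fun y => Qmat q y i j) x * wderiv (fun y => Qmat q y j i) x)).
  have m i j : measurable_fun Io (wderiv (fun y => Qmat q y i j)).
    by have [_ [] ] := inH1_primL2 (primL2_inH1 (primL2_Qmat i j h1 h2 h3)).
  by do 2 (apply: measurable_sum => ?); apply: measurable_funM; exact: m.
apply/funext => x; rewrite normsqE; apply: eq_bigr => i _; apply: eq_bigr => j _.
by rewrite !mxE.
Qed.

(** The integrand is stated with an additive term V so as to cover both the energy
and the H^1 norm. *)
Lemma integral_normsq_wderivmx (q g : triple R) (r : R) (V : R -> R) :
  primL2 (q1 q) (q1 g) -> primL2 (q2 q) (q2 g) -> primL2 (q3 q) (q3 g) ->
  {within Ic, continuous V} ->
  (\int[mu]_(x in Io) (r * normsq (wderivmx (Qmat q) x) + V x)%:E)%E =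
  (intg (-1) 1 (fun x => r * (6 * q1 g x ^+ 2 + 2 * q2 g x ^+ 2
     + 2 * q3 g x ^+ 2) + V x))%:E.
Proof.
move=> h1 h2 h3 cV.
have iV : inL1 (fun x => r * (6 * q1 g x ^+ 2 + 2 * q2 g x ^+ 2
     + 2 * q3 g x ^+ 2) + V x).
  have [[_ /inL2_sqr i1 _] [_ /inL2_sqr i2 _]] := (h1, h2).
  have [_ /inL2_sqr i3 _] := h3.
  apply: inL1D; last exact: wcont_L1.
  by apply: inL1Z; do ?apply: inL1D; apply: inL1Z.
rewrite /intg /Rintegral fineK; last first.
  by apply: integrable_fin_num iV; exact: Iopen_measurable.
apply: ae_eq_integral.
- exact: Iopen_measurable.
- apply/measurable_EFinP; apply: measurable_funD; last exact: wcont_meas.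
  apply: measurable_funM; first exact: measurable_cst.
  exact: measurable_normsq_wderivmx h1 h2 h3.
- exact: measurable_int iV.
- have := wderivmx_ae h1 h2 h3.
  apply: filterS; first exact: (ae_filter_ringOfSetsType mu).
  by move=> x hx Ix; rewrite hx// normsq_Qmat.
Qed.

End Tensors.

(** * The sharp Poincare inequality with its defect *)

Section Poincare.
Context {R : realType}.
Implicit Types (u v f g : R -> R) (a b c r e x k : R).
Local Notation Ic := (@Iclosed R).

Lemma is_derive_scale k x : is_derive x 1 (fun y => k * y) k.
Proof.
have := @is_deriveZ R R R id k x 1 1 (is_derive_id x 1).
by rewrite /GRing.scale /= mulr1.
Qed.

Lemma is_derive_cosM k x :
  is_derive x 1 (fun y => cos (k * y)) (- (k * sin (k * x))).
Proof.
have := is_derive1_comp (is_derive_cos (k * x)) (is_derive_scale k x).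
by rewrite mulrC mulrN.
Qed.

Lemma is_derive_sinM k x :
  is_derive x 1 (fun y => sin (k * y)) (k * cos (k * x)).
Proof.
have := is_derive1_comp (is_derive_sin (k * x)) (is_derive_scale k x).
by rewrite mulrC.
Qed.

Lemma continuous_cosM k : continuous (fun y => cos (k * y)).
Proof.
move=> x; apply: (@continuous_comp _ _ _ (fun y => k * y) cos).
  by apply: cvgM; [exact: cvg_cst|exact: cvg_id].
exact: continuous_cos.
Qed.

Lemma continuous_sinM k : continuous (fun y => sin (k * y)).
Proof.
move=> x; apply: (@continuous_comp _ _ _ (fun y => k * y) sin).
  by apply: cvgM; [exact: cvg_cst|exact: cvg_id].
exact: continuous_sin.
Qed.

Lemma primL2_cosM k :
  primL2 (fun x => cos (k * x)) (fun x => - (k * sin (k * x))).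
Proof.
apply: primL2_C1 => [x _|]; first exact: is_derive_cosM.
apply: continuous_wcont => x; apply: cvgN; apply: cvgM; first exact: cvg_cst.
exact: continuous_sinM.
Qed.

Lemma primL2_sinM k : primL2 (fun x => sin (k * x)) (fun x => k * cos (k * x)).
Proof.
apply: primL2_C1 => [x _|]; first exact: is_derive_sinM.
apply: continuous_wcont => x; apply: cvgM; first exact: cvg_cst.
exact: continuous_cosM.
Qed.

Definition secM k x : R := (cos (k * x))^-1.

Lemma cosM_gt0 k x : 0 < k -> k < pi / 2 -> -1 <= x <= 1 -> 0 < cos (k * x).
Proof.
by move=> k0 kpi /andP[x1 x2]; apply: cos_gt0_pihalf; apply/andP; split; nra.
Qed.

Lemma wcont_secM k : 0 < k -> k < pi / 2 -> {within Ic, continuous (secM k)}.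
Proof.
move=> k0 kpi; apply: continuous_in_subspaceT => x.
rewrite inE /Iclosed /= in_itv /= => hx.
apply: cvgV; first by rewrite gt_eqF ?cosM_gt0.
exact: continuous_cosM.
Qed.

Lemma primL2_secM k : 0 < k -> k < pi / 2 ->
  primL2 (secM k) (fun x => k * sin (k * x) * secM k x ^+ 2).
Proof.
move=> k0 kpi; apply: primL2_C1 => [x hx|].
  have c0 : cos (k * x) != 0 by rewrite gt_eqF ?cosM_gt0.
  have := is_deriveV c0 (is_derive_cosM k x).
  rewrite /GRing.scale /= mulrNN => h; apply: is_derive_eq h _.
  by rewrite /secM exprVn mulrC.
apply: wcontM; last by apply: wcontX; exact: wcont_secM.
apply: continuous_wcont => x; apply: cvgM; first exact: cvg_cst.
exact: continuous_sinM.
Qed.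

(** k tan(k x), the solution of T' = k ^ 2 + T ^ 2 that vanishes at 0. *)
Definition tanM k x : R := k * sin (k * x) * secM k x.

Lemma primL2_tanM k : 0 < k -> k < pi / 2 ->
  primL2 (tanM k) (fun x => k ^+ 2 * secM k x ^+ 2).
Proof.
move=> k0 kpi.
apply: primL2_ext (primL2M (primL2Z k (primL2_sinM k)) (primL2_secM k0 kpi)) => //.
  move=> x /andP[x1 x2]; have c0 : cos (k * x) != 0.
    by rewrite gt_eqF// cosM_gt0// !ltW.
  have := cos2Dsin2 (k * x); rewrite /secM.
  set C := cos _ in c0 *; set S := sin _ => CS.
  have -> : k ^+ 2 * C^-1 ^+ 2 = k ^+ 2 * (C ^+ 2 + S ^+ 2) * C^-1 ^+ 2.
    by rewrite CS mulr1.
  by field.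
apply: measurable_funM; first exact: measurable_cst.
by apply: measurable_funX; apply: wcont_meas; exact: wcont_secM.
Qed.

(** Let T be [tanM k]. As T z ^ 2 vanishes at -1 and 1, the right-hand difference of
integrals is the integral of (z' + T z) ^ 2. Moreover z' + T z is
cos(k x) times the derivative of z / cos(k x), so the Cauchy-Schwarz inequality
bounds the increments of z / cos(k x); the second factor comes from the integral
of 1 / cos(k x) ^ 2. *)
Lemma poincare_tan k z g a b : 0 < k -> k < pi / 2 -> primL2 z g ->
  z (-1) = 0 -> z 1 = 0 -> -1 <= a -> a <= b -> b <= 1 ->
  k ^+ 2 * (z b * secM k b - z a * secM k a) ^+ 2 <=
  (intg (-1) 1 (fun x => g x ^+ 2) - k ^+ 2 * intg (-1) 1 (fun x => z x ^+ 2)) *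
  (tanM k b - tanM k a).
Proof.
move=> k0 kpi ACz z0 z1 a1 ab b1; have [cz hg zg] := ACz.
have ACs := primL2_secM k0 kpi; have ACt := primL2_tanM k0 kpi.
have [cs _ _] := ACs; have [ct _ tt] := ACt.
pose r x := g x + z x * tanM k x.
have hzt : inL2 (fun x => z x * tanM k x) by apply: wcont_L2; exact: wcontM.
have hr : inL2 r by exact: inL2D.
have N11 : -1 <= -1 :> R by []. have P11 : 1 <= 1 :> R by [].
have N1 : -1 <= 1 :> R by lra.
have [_ _ /(_ a b a1 ab b1)] := primL2M ACz ACs.
rewrite (@eq_intg _ _ _ _ (fun x => r x * secM k x)) => [->|x _]; last first.
  by rewrite /r /tanM; ring.
(* The added term is the derivative of T z ^ 2, by T' = k ^ 2 + T ^ 2. *)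
have hr2 : intg (-1) 1 (fun x => r x ^+ 2) = intg (-1) 1 (fun x => g x ^+ 2)
    - k ^+ 2 * intg (-1) 1 (fun x => z x ^+ 2).
  have [_ hd /(_ (-1) 1 N11 N1 P11)] := primL2M ACt (primL2M ACz ACz).
  rewrite z0 z1 !mulr0 subrr => e0.
  rewrite (@eq_intg _ _ _ _ (fun x => (g x ^+ 2 - k ^+ 2 * z x ^+ 2) +
    (k ^+ 2 * secM k x ^+ 2 * (z x * z x) + tanM k x * (g x * z x + z x * g x)))).
    have i1 := inL2_sqr hg; have i2 := inL2_sqr (wcont_L2 cz).
    rewrite intgD//; [|by apply: inL1B => //; exact: inL1Z|exact: inL2_L1].
    by rewrite -e0 addr0 intgB ?intgZ//; exact: inL1Z.
  move=> x /andP[x1 x2]; rewrite /r /tanM /secM.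
  have c0 : cos (k * x) != 0 by rewrite gt_eqF// cosM_gt0// !ltW.
  have := cos2Dsin2 (k * x).
  set C := cos _ in c0 *; set S := sin _ => CS.
  have e : k ^+ 2 * C^-1 ^+ 2 = k ^+ 2 * (C ^+ 2 + S ^+ 2) * C^-1 ^+ 2.
    by rewrite CS mulr1.
  by rewrite e; field.
have hrab : intg a b (fun x => r x ^+ 2) <= intg (-1) 1 (fun x => r x ^+ 2).
  have h0 p q : 0 <= intg p q (fun x => r x ^+ 2).
    by apply: intg_ge0 => x _; exact: sqr_ge0.
  have ir := inL2_sqr hr.
  rewrite [leRHS](@intg_chasles _ _ _ _ _ _ a)//; last exact: le_trans b1.
  rewrite (@intg_chasles _ a 1 _ _ _ b)//.
  have := h0 (-1) a; have := h0 b 1; lra.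
have hs : k ^+ 2 * intg a b (fun x => secM k x ^+ 2) = tanM k b - tanM k a.
  by rewrite tt// intgZ//; apply: wcont_L1; exact: wcontX.
rewrite -hs -hr2 [leRHS]mulrCA ler_pM2l ?exprn_gt0//.
apply: le_trans (CauchySchwarz_intg a1 b1 hr (wcont_L2 cs)) _.
apply: ler_wpM2r => //; apply: intg_ge0 => x _; exact: sqr_ge0.
Qed.

(** Compare x with 0 in [poincare_tan]. Multiplying by cos(k x) ^ 2 turns the factor
tan(k x) into cos(k x) sin(k x), which keeps the bound uniform in x and in k. *)
Lemma poincare_subcritical k z g x : 0 < k -> k < pi / 2 -> primL2 z g ->
  z (-1) = 0 -> z 1 = 0 -> -1 <= x <= 1 ->
  k * (z x - z 0 * cos (k * x)) ^+ 2 <=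
  intg (-1) 1 (fun x => g x ^+ 2) - k ^+ 2 * intg (-1) 1 (fun x => z x ^+ 2).
Proof.
move=> k0 kpi ACz z0 z1 /andP[x1 x2].
set P := (X in _ <= X).
have c0 : 0 < cos (k * x) by rewrite cosM_gt0// x1.
have sec0 : secM k 0 = 1 by rewrite /secM mulr0 cos0 invr1.
have tan0 : tanM k 0 = 0 by rewrite /tanM mulr0 sin0 mulr0 mul0r.
have P0 : 0 <= P.
  have N1 : -1 <= 1 :> R by lra.
  have := poincare_tan k0 kpi ACz z0 z1 (lexx _) N1 (lexx _).
  rewrite z0 z1 !mul0r subrr expr0n mulr0 -/P.
  have : 0 < sin k by apply: sin_gt0_pi; rewrite k0/=; have := pi_gt0 R; lra.
  have : 0 < cos k by rewrite -[k]mulr1 cosM_gt0//; apply/andP; split; lra.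
  move=> hc hs; have t0 : 0 < k * sin k / cos k by rewrite divr_gt0 ?mulr_gt0.
  rewrite (_ : tanM k 1 - tanM k (-1) = 2 * (k * sin k / cos k)).
    have t2 : 0 < 2 * (k * sin k / cos k) by lra.
    by rewrite (pmulr_lge0 _ t2).
  by rewrite /tanM /secM mulr1 mulrN1 cosN sinN; ring.
suff key : k ^+ 2 * (z x * secM k x - z 0) ^+ 2 <= P * `|tanM k x|.
  have -> : z x - z 0 * cos (k * x) = (z x * secM k x - z 0) * cos (k * x).
    by rewrite /secM mulrBl mulfVK ?gt_eqF.
  move: key; set A := _ - _ => key.
  rewrite -(ler_pM2l k0).
  rewrite (_ : k * (k * (A * cos (k * x)) ^+ 2) =
    k ^+ 2 * A ^+ 2 * cos (k * x) ^+ 2); last by ring.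
  apply: (@le_trans _ _ (P * `|tanM k x| * cos (k * x) ^+ 2)).
    by apply: ler_wpM2r => //; exact: sqr_ge0.
  rewrite -[leLHS]mulrA [leRHS]mulrC ler_wpM2l//.
  rewrite /tanM /secM !normrM (gtr0_norm k0) normfV (gtr0_norm c0).
  rewrite expr2 !mulrA mulfVK ?gt_eqF// -[leRHS]mulr1 -mulrA ler_wpM2l ?ltW//.
  have := cos2Dsin2 (k * x); rewrite -[sin _ ^+ 2]real_normK ?num_real//.
  have := normr_ge0 (sin (k * x)); nra.
have [x0|x0] := leP 0 x.
  have := poincare_tan k0 kpi ACz z0 z1 _ x0 x2; rewrite -/P.
  rewrite sec0 tan0 mulr1 subr0 => /(_ _)/le_trans; apply; first lra.
  by rewrite ler_wpM2l// ler_norm.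
have := poincare_tan k0 kpi ACz z0 z1 x1 (ltW x0) _; rewrite -/P.
rewrite sec0 tan0 mulr1 sub0r => h.
rewrite (_ : (z x * secM k x - z 0) ^+ 2 = (z 0 - z x * secM k x) ^+ 2);
  last by ring.
apply: le_trans (h _) _; first lra.
by rewrite ler_wpM2l// -normrN ler_norm.
Qed.

(** The functions cos(k x), k < pi / 2, have no zero on [-1, 1]; the critical case
follows by letting k tend to pi / 2, where 1 / cos(k x) is singular at the ends. *)
Lemma poincare_defect z g x : primL2 z g -> z (-1) = 0 -> z 1 = 0 ->
  -1 <= x <= 1 ->
  pi / 2 * (z x - z 0 * cos (pi / 2 * x)) ^+ 2 <=
  intg (-1) 1 (fun x => g x ^+ 2)
  - (pi / 2) ^+ 2 * intg (-1) 1 (fun x => z x ^+ 2).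
Proof.
move=> ACz z0 z1 hx; rewrite -subr_ge0.
set G := intg _ _ _; set Z := intg _ _ _.
pose h (k : R) := G - k ^+ 2 * Z - k * (z x - z 0 * cos (k * x)) ^+ 2.
have ch : continuous h.
  have cc : continuous (fun k : R => cos (k * x)).
    move=> k; rewrite (_ : (fun y => _) = fun y => cos (x * y)).
      exact: continuous_cosM.
    by apply/funext => y; rewrite mulrC.
  move=> k; apply: cvgB.
    apply: cvgB; first exact: cvg_cst.
    by apply: cvgM; [exact: exprn_continuous|exact: cvg_cst].
  apply: cvgM; first exact: cvg_id.
  apply: (@continuous_comp _ _ _ (fun k => z x - z 0 * cos (k * x))
    (fun t => t ^+ 2)); last exact: exprn_continuous.
  apply: cvgB; first exact: cvg_cst.
  by apply: cvgM; [exact: cvg_cst|exact: cc].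
have p0 : 0 < pi / 2 :> R by rewrite divr_gt0// pi_gt0.
apply: (@cvgr_to_ge _ (pi / 2)^'- _ R h).
  by apply: cvg_at_left_filter; exact: ch.
near=> k; rewrite subr_ge0; apply: poincare_subcritical => //.
Unshelve. all: by end_near. Qed.

End Poincare.

(** * Low energy confines the map near the circle of minimizers *)

Section Confinement.
Context {R : realType}.
Implicit Types (u v f g : R -> R) (a b c r e x k m : R).
Local Notation Ic := (@Iclosed R).

Lemma intg_mono f a b : inL1 f -> (forall x, -1 < x < 1 -> 0 <= f x) ->
  -1 <= a -> a <= b -> b <= 1 -> intg a b f <= intg (-1) 1 f.
Proof.
move=> hf f0 a1 ab b1.
have h0 p q : -1 <= p -> q <= 1 -> 0 <= intg p q f.
  move=> p1 q1; apply: intg_ge0 => x /andP[px xq]; apply: f0.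
  by rewrite (le_lt_trans p1 px) (lt_le_trans xq q1).
have N11 : -1 <= -1 :> R by []. have P11 : 1 <= 1 :> R by [].
rewrite [leRHS](@intg_chasles _ _ _ _ _ _ a)//; last exact: le_trans b1.
rewrite (@intg_chasles _ a 1 _ _ _ b)//.
have := h0 (-1) a N11 (le_trans ab b1); have := h0 b 1 (le_trans a1 ab) P11.
lra.
Qed.

Lemma primL2_holder_norm u g (K x y : R) : primL2 u g ->
  intg (-1) 1 (fun x => g x ^+ 2) <= K ->
  -1 <= x <= 1 -> -1 <= y <= 1 -> (u y - u x) ^+ 2 <= `|y - x| * K.
Proof.
move=> ACu gK; wlog xy : x y / x <= y => [H hx hy|/andP[x1 _] /andP[_ y1]].
  have [xy|/ltW yx] := leP x y; first exact: H.
  by rewrite -sqrrN opprB distrC; exact: H.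
apply: le_trans (primL2_holder ACu x1 xy y1) _.
rewrite ger0_norm ?subr_ge0// ler_wpM2l ?subr_ge0//; apply: le_trans gK.
have [_ hg _] := ACu.
by apply: intg_mono => //; [exact: inL2_sqr|move=> z _; exact: sqr_ge0].
Qed.

Lemma primL2_bounded u g (K B x : R) : primL2 u g ->
  intg (-1) 1 (fun x => g x ^+ 2) <= K -> 0 < K -> 0 <= u (-1) <= B ->
  -1 <= x <= 1 -> `|u x| <= B + K + 1.
Proof.
move=> ACu gK K0 /andP[u0 us] hx.
have N11 : (-1 <= -1 :> R) && (-1 <= 1 :> R) by apply/andP; split; lra.
have h1 := primL2_holder_norm ACu gK N11 hx.
have x2 : `|x - -1| <= 2 by move/andP: hx => [? ?]; rewrite ger0_norm; lra.
have h2 := le_trans h1 (ler_wpM2r (ltW K0) x2).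
have : `|u x - u (-1)| <= K + 1.
  rewrite -(@ler_pXn2r _ 2) ?nnegrE ?addr_ge0 ?(ltW K0)// real_normK ?num_real//.
  by apply: le_trans h2 _; have := sqr_ge0 K; lra.
by rewrite !ler_norml => /andP[? ?]; apply/andP; split; lra.
Qed.

Lemma primL2_sqr_osc u g (K B h x y : R) : primL2 u g ->
  intg (-1) 1 (fun x => g x ^+ 2) <= K -> 0 < K -> 0 <= B ->
  (forall x, -1 <= x <= 1 -> `|u x| <= B) ->
  -1 <= x <= 1 -> -1 <= y <= 1 -> `|y - x| <= h ->
  (u y ^+ 2 - u x ^+ 2) ^+ 2 <= h * ((2 * B) ^+ 2 * K).
Proof.
move=> ACu gK K0 B0 uB hx hy yx.
have h1 : (u y - u x) ^+ 2 <= h * K.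
  by apply: le_trans (primL2_holder_norm ACu gK hx hy) _; rewrite ler_pM2r.
have h2 : (u y + u x) ^+ 2 <= (2 * B) ^+ 2.
  rewrite -[(u y + _) ^+ 2]real_normK ?num_real//.
  rewrite ler_pXn2r ?nnegrE ?mulr_ge0//.
  by apply: le_trans (ler_normD _ _) _; have := uB _ hx; have := uB _ hy; lra.
rewrite subr_sqr exprMn (_ : h * _ = h * K * (2 * B) ^+ 2); last by ring.
exact: ler_pM (sqr_ge0 _) (sqr_ge0 _) h1 h2.
Qed.

Lemma dist_window (p q r e : R) : `|p - r| = e -> `|q - p| <= e / 2 ->
  e / 2 <= `|q - r| <= 3 * e / 2.
Proof.
move=> pe qp; have := ler_normD (q - p) (p - r).
have := ler_normB (q - r) (q - p).
rewrite addrA subrK (_ : q - r - (q - p) = p - r); last by ring.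
by rewrite pe => ? ?; apply/andP; split; lra.
Qed.

Lemma continuous_potential theta c :
  continuous (fun am : R * R => potential theta c am.1 am.2).
Proof.
move=> am.
have c1 : (fun p : R * R => p.1) @ am --> am.1 by exact: cvg_fst.
have c2 : (fun p : R * R => p.2) @ am --> am.2 by exact: cvg_snd.
have cX n (f : R * R -> R) (l : R) : f @ am --> l ->
    (fun p => f p ^+ n) @ am --> l ^+ n.
  move=> cf; apply: (@cvg_comp _ _ _ f (fun t => t ^+ n) _ _ _ cf).
  exact: exprn_continuous.
have cA : (fun p : R * R => 6 * p.1 ^+ 2 + 2 * p.2) @ am -->
    6 * am.1 ^+ 2 + 2 * am.2.
  apply: cvgD; apply: cvgM; try exact: cvg_cst; last exact: c2.
  exact: cX.
apply: cvgD; last exact: cvg_cst.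
apply: cvgD; last by apply: cvgM; [exact: cvg_cst|exact: cX].
apply: cvgB; last first.
  by apply: cvgM; last exact: c2; apply: cvgM; [exact: cvg_cst|exact: c1].
apply: cvgD; apply: cvgM; try exact: cvg_cst; first exact: cA.
exact: cX.
Qed.

Lemma wcont_potential theta c (t : triple R) : {within Ic, continuous (q1 t)} ->
  {within Ic, continuous (q2 t)} -> {within Ic, continuous (q3 t)} ->
  {within Ic, continuous
     (fun x => potential theta c (q1 t x) (q2 t x ^+ 2 + q3 t x ^+ 2))}.
Proof.
move=> c1 c2 c3; have cm := wcontD (wcontX (n:=2) c2) (wcontX (n:=2) c3).
have cA := wcontD (wcontZ (r:=6) (wcontX (n:=2) c1)) (wcontZ (r:=2) cm).
apply: wcontD; last exact: wcont_cst.
apply: wcontD; last by apply: wcontZ; exact: wcontX.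
apply: wcontB; last by apply: wcontM => //; exact: wcontZ.
by apply: wcontD; [exact: wcontZ|apply: wcontZ; exact: wcontX].
Qed.

Section Tube.
Variables (theta c s K : R).
Hypothesis F_ge0 : forall a m, 0 <= m -> 0 <= potential theta c a m.
Hypothesis F_eq0 : forall a m, 0 <= m -> potential theta c a m = 0 ->
  m = 0 \/ m = (3 * s) ^+ 2.

(** The strip is compact and contains no zero of the potential: the bound on eta
keeps m positive in it. *)
Lemma potential_strip (B eta : R) : 0 <= B -> 0 < eta -> 2 * eta <= (3 * s) ^+ 2 ->
  exists2 delta : R, 0 < delta &
    forall a m, `|a| <= B -> eta / 2 <= `|m - (3 * s) ^+ 2| <= 3 * eta / 2 ->
      delta <= potential theta c a m.
Proof.
move=> B0 e0 e9; set m0 := (3 * s) ^+ 2 in e9 *.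
pose A := `[-B, B] `*` (`[m0 - 3 * eta / 2, m0 - eta / 2] `|`
                        `[m0 + eta / 2, m0 + 3 * eta / 2]) : set (R * R).
have cA : compact A.
  by apply: compact_setX; [|apply: compactU]; exact: segment_compact.
have A0 : A !=set0.
  by exists (0, m0 - eta / 2); split; rewrite /= ?in_itv /=;
    [apply/andP; split; lra|left; apply/andP; split; lra].
have cF : {within A, continuous (fun am : R * R => potential theta c am.1 am.2)}.
  by apply: continuous_subspaceT; exact: continuous_potential.
have [[a1 m1]] := compact_EVT_min A0 cA cF.
rewrite inE /A /= => -[_ hm1] hmin.
exists (potential theta c a1 m1) => [|a m aB hm].
  have m1p : 0 < m1 /\ m1 != m0.
    case: hm1; rewrite !in_itv /= => /andP[? ?].
      by split; [lra|rewrite lt_eqF//; lra].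
    by split; [lra|rewrite gt_eqF//; lra].
  case: m1p => m1p m1n; rewrite lt_def F_ge0 ?ltW// andbT.
  apply/eqP => /(F_eq0 (ltW m1p)) [m10|/eqP]; last by rewrite (negPf m1n).
  by rewrite m10 ltxx in m1p.
apply: (hmin (a, m)); rewrite inE; split.
  by move: aB; rewrite /= in_itv /= ler_norml.
move: hm => /=; rewrite !in_itv /=.
have [h|h] := leP 0 (m - m0).
  by rewrite ger0_norm// => /andP[? ?]; right; apply/andP; split; lra.
by rewrite ltr0_norm// => /andP[? ?]; left; apply/andP; split; lra.
Qed.

(** If the distance from q2 ^ 2 + q3 ^ 2 to (3 s) ^ 2, zero at -1, exceeded eta
somewhere, it would equal eta at some point by continuity, and remain between
eta / 2 and 3 eta / 2 over an interval of length h that depends only on eta, K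
and s. There the potential is at least delta > 0, so that lambda ^ 2 delta h <= K,
which fails for large lambda. *)
Lemma confinement (eta : R) : 0 < s -> 0 < K -> 0 < eta ->
  2 * eta <= (3 * s) ^+ 2 ->
  exists2 L : R, 0 < L & forall (lambda : R) (q g : triple R), L <= lambda ->
    primL2 (q1 q) (q1 g) -> primL2 (q2 q) (q2 g) -> primL2 (q3 q) (q3 g) ->
    q1 q (-1) = s -> q2 q (-1) = 3 * s -> q3 q (-1) = 0 ->
    intg (-1) 1 (fun x => q1 g x ^+ 2) <= K ->
    intg (-1) 1 (fun x => q2 g x ^+ 2) <= K ->
    intg (-1) 1 (fun x => q3 g x ^+ 2) <= K ->
    lambda ^+ 2 * intg (-1) 1
      (fun x => potential theta c (q1 q x) (q2 q x ^+ 2 + q3 q x ^+ 2)) <= K ->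
    forall x, -1 <= x <= 1 ->
      `|q2 q x ^+ 2 + q3 q x ^+ 2 - (3 * s) ^+ 2| <= eta.
Proof.
move=> s0 K0 e0 e9; pose B := 3 * s + K + 1.
have B0 : 0 < B by rewrite /B; lra.
have [delta d0 hd] := potential_strip (ltW B0) e0 e9.
(* Over a length h, q2 ^ 2 + q3 ^ 2 varies by at most eta / 2. *)
pose h := Num.min 1 ((eta / 2) ^+ 2 / ((4 * B) ^+ 2 * K)).
have h0 : 0 < h.
  by rewrite lt_min ltr01 divr_gt0 ?mulr_gt0 ?exprn_gt0 ?divr_gt0 ?mulr_gt0.
have h1 : h <= 1 by rewrite ge_min lexx.
have hh : h * ((4 * B) ^+ 2 * K) <= (eta / 2) ^+ 2.
  by rewrite -ler_pdivlMr ?mulr_gt0 ?exprn_gt0 ?mulr_gt0// ge_min lexx orbT.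
have dh0 : 0 < delta * h by rewrite mulr_gt0.
exists (K / (delta * h) + 1) => [|lambda q g hL AC1 AC2 AC3 b1 b2 b3 K1 K2 K3 KF].
  by rewrite ltr_wpDl// divr_ge0// ltW.
have l1 : 1 < lambda.
  by apply: lt_le_trans hL; rewrite ltrDr divr_gt0.
have KL : K < lambda ^+ 2 * (delta * h).
  apply: (@lt_le_trans _ _ (lambda * (delta * h))).
    by rewrite -ltr_pdivrMr//; apply: lt_le_trans hL; rewrite ltrDl.
  by rewrite ler_pM2r// expr2 ler_peMl// ltW// (lt_trans ltr01).
have s03 : (0 <= 0 :> R) && (0 <= 3 * s) by apply/andP; split; lra.
have s3 : (0 <= s) && (s <= 3 * s) by apply/andP; split; lra.
have s33 : (0 <= 3 * s) && (3 * s <= 3 * s) by apply/andP; split; lra.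
have B1 x (hx : -1 <= x <= 1) : `|q1 q x| <= B.
  by apply: (primL2_bounded AC1 K1 K0 _ hx); rewrite b1.
have B2 x (hx : -1 <= x <= 1) : `|q2 q x| <= B.
  by apply: (primL2_bounded AC2 K2 K0 _ hx); rewrite b2.
have B3 x (hx : -1 <= x <= 1) : `|q3 q x| <= B.
  by apply: (primL2_bounded AC3 K3 K0 _ hx); rewrite b3.
pose m x := q2 q x ^+ 2 + q3 q x ^+ 2.
have [c1 _ _] := AC1; have [c2 _ _] := AC2; have [c3 _ _] := AC3.
have cm : {within Ic, continuous m} by apply: wcontD; exact: wcontX.
have osc x y : -1 <= x <= 1 -> -1 <= y <= 1 -> `|y - x| <= h ->
    `|m y - m x| <= eta / 2.
  move=> hx hy yx.
  rewrite -(@ler_pXn2r _ 2) ?nnegrE ?divr_ge0 ?(ltW e0)// real_normK ?num_real//.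
  apply: le_trans hh.
  have := primL2_sqr_osc AC2 K2 K0 (ltW B0) B2 hx hy yx.
  have := primL2_sqr_osc AC3 K3 K0 (ltW B0) B3 hx hy yx; rewrite /m.
  set a := q3 q y ^+ 2 - _; set b := q2 q y ^+ 2 - _ => Ha Hb.
  rewrite (_ : _ - _ = a + b); last by rewrite /a /b; ring.
  have := sqr_ge0 (a - b); nra.
move=> x hx; rewrite leNgt; apply/negP => mx.
have [x1 /andP[x11 x12] mx1] : exists2 x1, -1 <= x1 <= 1 &
    `|m x1 - (3 * s) ^+ 2| = eta.
  have [hx1 hx2] := andP hx.
  have cn : {within `[-1, x], continuous (fun y => `|m y - (3 * s) ^+ 2|)}.
    apply: (@continuous_subspaceW _ _ _ Ic).
      by move=> y; rewrite /Iclosed /= !in_itv /= => /andP[-> /le_trans ->].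
    have cc := wcontB cm (@wcont_cst _ ((3 * s) ^+ 2)).
    by move=> y; apply: cvg_norm; exact: (cc y).
  have [|x1] := @IVT R (fun y => `|m y - (3 * s) ^+ 2|) (-1) x eta hx1 cn.
    rewrite /m b2 b3 expr0n addr0 subrr normr0 ge_min le_max.
    by rewrite (ltW e0) (ltW mx) orbT.
  by rewrite in_itv /= => /andP[? x1x] mx1; exists x1 => //;
    apply/andP; split=> //; exact: le_trans hx2.
have [a [a1 a2 ah]] : exists a, [/\ -1 <= a, a + h <= 1 & a <= x1 <= a + h].
  have [x10|x10] := leP x1 0.
    by exists x1; split => //; [lra|apply/andP; split; lra].
  by exists (x1 - h); split; [lra|lra|apply/andP; split; lra].
pose F x := potential theta c (q1 q x) (m x).
have F0 y : 0 <= F y by apply: F_ge0; rewrite addr_ge0 ?sqr_ge0.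
have iF : inL1 F by apply: wcont_L1; exact: wcont_potential.
have aah : a <= a + h by lra.
have lowF : delta * h <= intg a (a + h) F.
  have -> : delta * h = intg a (a + h) (fun=> delta).
    by rewrite intg_cst//; ring.
  apply: intg_le => //; first exact: inL1_cst.
  move=> y /andP[ay yah]; have hy : -1 <= y <= 1 by apply/andP; split; lra.
  apply: hd; first exact: B1.
  have [ax1 x1a] := andP ah.
  have hx1 : -1 <= x1 <= 1 by rewrite x11 x12.
  have /(osc _ _ hx1 hy) : `|y - x1| <= h.
    by rewrite ler_norml; apply/andP; split; lra.
  exact: dist_window.
have := intg_mono iF (fun y _ => F0 y) a1 aah a2.
move=> /(le_trans lowF) lF.
have l20 : 0 < lambda ^+ 2 by rewrite exprn_gt0// (lt_trans ltr01).
have := ler_wpM2l (ltW l20) lF.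
move=> /le_trans /(_ KF); lra.
Qed.

End Tube.

End Confinement.

(** * Rigidity of nearly optimal half-turns *)

Section Rigidity.
Context {R : realType}.
Implicit Types (u v f g : R -> R) (a b c r e x k m : R).

Lemma eighth_turn (C := cos (pi / 2 * (1 / 2)) : R)
    (S := sin (pi / 2 * (1 / 2)) : R) :
  0 < C /\ S = C /\ C ^+ 2 = 1 / 2.
Proof.
have p0 := pi_gt0 R.
have C0 : 0 < C by apply: cos_gt0_pihalf; apply/andP; split; lra.
have S0 : 0 < S by apply: sin_gt0_pi; apply/andP; split; lra.
have := cos_pihalf R; rewrite (_ : pi / 2 = pi / 2 * (1 / 2) + pi / 2 * (1 / 2));
  last by field.
rewrite cosD -/C -/S => CS; have C1 : C ^+ 2 + S ^+ 2 = 1 by exact: cos2Dsin2.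
have SC : S = C.
  have : (C - S) * (C + S) = 0 by rewrite -[RHS]CS; ring.
  move/eqP; rewrite mulf_eq0 => /orP[/eqP|/eqP]; lra.
by split=> //; split=> //; move: C1; rewrite SC; lra.
Qed.

Lemma sinM_end : sin (pi / 2 * (-1)) = -1 :> R /\ sin (pi / 2 * 1) = 1 :> R.
Proof. by rewrite mulrN1 mulr1 sinN sin_pihalf. Qed.

Lemma cosM_end : cos (pi / 2 * (-1)) = 0 :> R /\ cos (pi / 2 * 1) = 0 :> R.
Proof. by rewrite mulrN1 mulr1 cosN cos_pihalf. Qed.

(** The first hypothesis on a and b is the constraint at x = 0, the last one the
constraint at x = 1/2, where cos and sin of pi / 2 x have the common value C.
Up to the errors d1 and d2, the latter reads C ^ 2 ((a - rho) ^ 2 + b ^ 2) =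
rho ^ 2, and since a ^ 2 + b ^ 2 is close to rho ^ 2 its left-hand side is close to
rho ^ 2 - rho a. *)
Lemma rigidity_two_points (rho e a b C d1 d2 : R) :
  0 < rho -> 0 < e -> e <= 1 -> 0 <= b -> 0 < C -> C ^+ 2 = 1 / 2 ->
  `|a ^+ 2 + b ^+ 2 - rho ^+ 2| <= e -> `|d1| <= e -> `|d2| <= e ->
  `|(- rho * C + a * C + d1) ^+ 2 + (b * C + d2) ^+ 2 - rho ^+ 2| <= e ->
  rho * `|a| <= e * (6 * rho + 8) /\ rho * `|b - rho| <= e + a ^+ 2.
Proof.
move=> r0 e0 e1 b0 C0 C2; rewrite !ler_norml.
move=> /andP[h1 h2] /andP[x1 x2] /andP[y1 y2].
have C1 : C <= 1 by nra.
have a1 : - (rho + 1) <= a <= rho + 1 by apply/andP; split; nra.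
have b1 : b <= rho + 1 by nra.
have -> : (- rho * C + a * C + d1) ^+ 2 + (b * C + d2) ^+ 2 - rho ^+ 2 =
    C ^+ 2 * (rho ^+ 2 + (a ^+ 2 + b ^+ 2) - 2 * (rho * a)) - rho ^+ 2
    + (2 * (C * (a - rho) * d1 + C * b * d2) + d1 ^+ 2 + d2 ^+ 2) by ring.
rewrite C2; set X := 2 * _ + _ + _; move=> /andP[z1 z2].
have cross (p d M : R) : `|p| <= M -> - e <= d -> d <= e -> `|C * p * d| <= M * e.
  move=> pM d1' d2'; have de : `|d| <= e by rewrite ler_norml d1'.
  rewrite !normrM (gtr0_norm C0).
  have M0 := le_trans (normr_ge0 _) pM.
  apply: ler_pM => //; first by rewrite mulr_ge0 ?(ltW C0).
  by rewrite -[leRHS]mul1r; apply: ler_pM => //; exact: ltW.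
have X1 : `|X| <= e * (6 * rho + 6).
  have w1 : `|a - rho| <= 2 * rho + 1.
    by rewrite ler_norml; case/andP: a1 => ? ?; apply/andP; split; lra.
  have w2 : `|b| <= rho + 1 by rewrite ger0_norm.
  have := cross _ _ _ w1 x1 x2; have := cross _ _ _ w2 y1 y2.
  rewrite /X !ler_norml => /andP[? ?] /andP[? ?].
  have q1 : d1 ^+ 2 <= e by nra.
  have q2 : d2 ^+ 2 <= e by nra.
  have q10 := sqr_ge0 d1; have q20 := sqr_ge0 d2.
  by apply/andP; split; lra.
move: X1; rewrite ler_norml => /andP[X1 X2].
split.
  rewrite -(gtr0_norm r0) -normrM ler_norml (gtr0_norm r0).
  by apply/andP; split; lra.
have ab : `|b ^+ 2 - rho ^+ 2| <= e + a ^+ 2.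
  by rewrite ler_norml; have := sqr_ge0 a; move=> ?; apply/andP; split; lra.
apply: le_trans ab; rewrite subr_sqr normrM mulrC ler_wpM2l//.
by rewrite ger0_norm; lra.
Qed.

Section Planar.
Variables (rho : R) (q2 q3 g2 g3 : R -> R).
Local Notation k := (pi / 2 : R).
Local Notation C x := (cos (pi / 2 * x)).
Local Notation S x := (sin (pi / 2 * x)).
Hypotheses (AC2 : primL2 q2 g2) (AC3 : primL2 q3 g3).
Hypotheses (q2N : q2 (-1) = rho) (q2P : q2 1 = - rho).
Hypotheses (q3N : q3 (-1) = 0) (q3P : q3 1 = 0).

Local Notation w2 := (fun x => q2 x + rho * S x).
Local Notation h2 := (fun x => g2 x + rho * (k * C x)).
Local Notation w3 := (fun x => q3 x - rho * C x).
Local Notation h3 := (fun x => g3 x - rho * - (k * S x)).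

Lemma primL2_w2 : primL2 w2 h2.
Proof. by apply: primL2D => //; apply: primL2Z; exact: primL2_sinM. Qed.

Lemma primL2_w3 : primL2 w3 h3.
Proof. by apply: primL2B => //; apply: primL2Z; exact: primL2_cosM. Qed.

Lemma null_integral u g : primL2 u g -> u (-1) = u 1 -> intg (-1) 1 g = 0.
Proof.
move=> [_ _ ug] u11; rewrite -ug ?u11 ?subrr//; lra.
Qed.

Lemma null_g2 : intg (-1) 1 (fun x => g2 x * C x + q2 x * - (k * S x)) = 0.
Proof.
apply: null_integral (primL2M AC2 (primL2_cosM _)) _.
by have [-> ->] := cosM_end; rewrite !mulr0.
Qed.

Lemma null_g3 : intg (-1) 1 (fun x => g3 x * S x + q3 x * (k * C x)) = 0.
Proof.
apply: null_integral (primL2M AC3 (primL2_sinM _)) _.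
by rewrite q3N q3P !mul0r.
Qed.

Lemma null_cos2 : intg (-1) 1 (fun x => k * C x * C x + S x * - (k * S x)) = 0.
Proof.
apply: null_integral (primL2M (primL2_sinM _) (primL2_cosM _)) _.
by have [-> ->] := cosM_end; rewrite !mulr0.
Qed.

(** The cross terms between q2 and rho sin(k x) cancel because sin(k x) solves
z'' = - k ^ 2 z, and the terms in rho ^ 2 because cos(k x) ^ 2 and sin(k x) ^ 2 have
the same integral. *)
Lemma poincare_sum :
  intg (-1) 1 (fun x => h2 x ^+ 2) - k ^+ 2 * intg (-1) 1 (fun x => w2 x ^+ 2)
  + (intg (-1) 1 (fun x => g3 x ^+ 2) - k ^+ 2 * intg (-1) 1 (fun x => q3 x ^+ 2))
  = intg (-1) 1 (fun x => g2 x ^+ 2 + g3 x ^+ 2)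
    - k ^+ 2 * intg (-1) 1 (fun x => q2 x ^+ 2 + q3 x ^+ 2).
Proof.
have [cw2 /inL2_sqr ih2 _] := primL2_w2.
have [c2 _ _] := AC2; have [c3 /inL2_sqr ig3 _] := AC3.
have [_ /inL2_sqr ig2 _] := AC2.
have iw2 := inL2_sqr (wcont_L2 cw2); have iq3 := inL2_sqr (wcont_L2 c3).
have iq2 := inL2_sqr (wcont_L2 c2).
have [_ /inL2_L1 in2 _] := primL2M AC2 (primL2_cosM k).
have [_ /inL2_L1 inC _] := primL2M (primL2_sinM k) (primL2_cosM k).
have N1 : -1 <= -1 :> R by []. have P1 : 1 <= 1 :> R by [].
have ig := inL1D ig2 ig3; have iq := inL1D iq2 iq3.
have d2 := inL1B ih2 (inL1Z (k ^+ 2) iw2).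
have d3 := inL1B ig3 (inL1Z (k ^+ 2) iq3).
have dq := inL1B ig (inL1Z (k ^+ 2) iq).
rewrite -!intgZ// -(intgB N1 P1 ih2 (inL1Z _ iw2)).
rewrite -(intgB N1 P1 ig3 (inL1Z _ iq3)) -(intgB N1 P1 ig (inL1Z _ iq)).
rewrite -(intgD N1 P1 d2 d3).
(* n2 and nC are derivatives of functions with equal values at the ends. *)
pose n2 := fun x => g2 x * C x + q2 x * - (k * S x).
pose nC := fun x => k * C x * C x + S x * - (k * S x).
transitivity (intg (-1) 1 (fun x => (g2 x ^+ 2 + g3 x ^+ 2
    - k ^+ 2 * (q2 x ^+ 2 + q3 x ^+ 2))
    + (2 * rho * k * n2 x + rho ^+ 2 * k * nC x))).
  by apply: eq_intg => x _; rewrite /n2 /nC; ring.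
rewrite (intgD N1 P1 dq (inL1D (inL1Z (2 * rho * k) in2)
  (inL1Z (rho ^+ 2 * k) inC))).
rewrite (intgD N1 P1 (inL1Z (2 * rho * k) in2) (inL1Z (rho ^+ 2 * k) inC)).
by rewrite !(intgZ N1 P1)// null_g2 null_cos2 !mulr0 !addr0.
Qed.

(** The half-turn v solves v'' = - k ^ 2 v. Expanding the square and integrating the
cross terms by parts leaves the excess of kinetic energy over the half-turn, which
is nonpositive, plus 2 rho k ^ 2 times the integral of w2 sin(k x) - w3 cos(k x). *)
Lemma kinetic_gap (g1 : R -> R) (d : R) : inL2 g1 ->
  intg (-1) 1 (fun x => 3 * g1 x ^+ 2 + g2 x ^+ 2 + g3 x ^+ 2)
    <= 2 * rho ^+ 2 * k ^+ 2 ->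
  0 <= rho -> (forall x, -1 <= x <= 1 -> `|w2 x| <= d) ->
  (forall x, -1 <= x <= 1 -> `|w3 x| <= d) ->
  intg (-1) 1 (fun x => 3 * g1 x ^+ 2 + h2 x ^+ 2 + h3 x ^+ 2)
    <= 8 * rho * k ^+ 2 * d.
Proof.
move=> /inL2_sqr ig1 E r0 w2d w3d.
have [cw2 _ _] := primL2_w2; have [cw3 _ _] := primL2_w3.
have [_ /inL2_sqr ig2 _] := AC2; have [_ /inL2_sqr ig3 _] := AC3.
have [_ /inL2_L1 in2 _] := primL2M AC2 (primL2_cosM k).
have [_ /inL2_L1 in3 _] := primL2M AC3 (primL2_sinM k).
have cS := continuous_wcont (@continuous_sinM R k).
have cC := continuous_wcont (@continuous_cosM R k).
have N1 : -1 <= -1 :> R by []. have P1 : 1 <= 1 :> R by [].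
have N11 : -1 <= 1 :> R by lra.
(* n2 and n3 are derivatives of functions that vanish at both ends. *)
pose n2 := fun x => g2 x * C x + q2 x * - (k * S x).
pose n3 := fun x => g3 x * S x + q3 x * (k * C x).
pose en := fun x => 3 * g1 x ^+ 2 + g2 x ^+ 2 + g3 x ^+ 2.
pose f := fun x => w2 x * S x - w3 x * C x.
have ien : inL1 en by apply: inL1D => //; apply: inL1D => //; exact: inL1Z.
have icf : inL1 f by apply: wcont_L1; apply: wcontB; exact: wcontM.
pose A := 2 * rho * k; pose B := 2 * rho * k ^+ 2.
have i1 := inL1D ien (inL1Z A in2).
have i2 := inL1D i1 (inL1Z A in3).
have i3 : inL1 (fun x => - (rho ^+ 2 * k ^+ 2) + B * f x).
  by apply: inL1D; [exact: inL1_cst|exact: inL1Z].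
rewrite (@eq_intg _ _ _ _ (fun x => en x + A * n2 x + A * n3 x
    + (- (rho ^+ 2 * k ^+ 2) + B * f x))); last first.
  move=> x _; rewrite /en /n2 /n3 /f /A /B; have := cos2Dsin2 (k * x).
  set c := cos _; set s := sin _ => cs.
  transitivity (3 * g1 x ^+ 2 + g2 x ^+ 2 + g3 x ^+ 2
    + A * (g2 x * c + q2 x * - (k * s)) + A * (g3 x * s + q3 x * (k * c))
    + (- (rho ^+ 2 * k ^+ 2) * (c ^+ 2 + s ^+ 2)
    + B * ((q2 x + rho * s) * s - (q3 x - rho * c) * c))).
    by rewrite /A /B; ring.
  by rewrite cs mulr1.
rewrite (intgD N1 P1 i2 i3) (intgD N1 P1 i1 (inL1Z A in3)).
rewrite (intgD N1 P1 ien (inL1Z A in2)) (intgD N1 P1 (inL1_cst _) (inL1Z B icf)).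
rewrite !(intgZ N1 P1)// intg_cst// null_g2 null_g3 !mulr0 !addr0.
have B0 : 0 <= B by apply: mulr_ge0; [exact: mulr_ge0|exact: sqr_ge0].
have fle : intg (-1) 1 f <= 4 * d.
  have -> : 4 * d = intg (-1) 1 (fun=> 2 * d) by rewrite intg_cst//; ring.
  apply: intg_le => //; first exact: inL1_cst.
  move=> x /andP[/ltW x1 /ltW x2]; have hx : -1 <= x <= 1 by rewrite x1.
  have := cos2Dsin2 (k * x); rewrite /f.
  have := w2d x hx; have := w3d x hx.
  set c := cos _; set s := sin _; set u := q2 x + _; set v := q3 x - _.
  move=> vd ud cs; have d0 := le_trans (normr_ge0 _) vd.
  have c1 : `|c| <= 1 by rewrite ler_norml; apply/andP; split; nra.
  have s1 : `|s| <= 1 by rewrite ler_norml; apply/andP; split; nra.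
  have us : `|u * s| <= d * 1 by rewrite normrM; exact: ler_pM.
  have vc : `|v * c| <= d * 1 by rewrite normrM; exact: ler_pM.
  move: us vc; rewrite !ler_norml => /andP[? ?] /andP[? ?]; lra.
have := ler_wpM2l B0 fle; move: E; rewrite -/en /B; lra.
Qed.

(** The bound on eta by e ^ 2 / pi makes the Poincare deficits of w2 and q3 at most
k e ^ 2, so both functions are within e of multiples of cos(k x). The tube
condition at 0 and 1/2 then determines these multiples; the sign of q3 0 selects the
upper half-turn. *)
Lemma close_to_geodesic (e eta : R) : 0 < rho -> 0 < e -> e <= 1 -> eta <= e ->
  pi * eta <= e ^+ 2 -> 0 <= q3 0 ->
  intg (-1) 1 (fun x => g2 x ^+ 2 + g3 x ^+ 2) <= 2 * rho ^+ 2 * k ^+ 2 ->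
  (forall x, -1 <= x <= 1 -> `|q2 x ^+ 2 + q3 x ^+ 2 - rho ^+ 2| <= eta) ->
  forall x, -1 <= x <= 1 ->
    rho * `|w2 x| <= e * (7 * rho + 8) /\
    rho * `|w3 x| <= e * (rho + 1) + q2 0 ^+ 2 /\
    rho * `|q2 0| <= e * (6 * rho + 8).
Proof.
move=> r0 e0 e1 ee pie b0 E tub.
have p0 := pi_gt0 R; have k0 : 0 < k by rewrite divr_gt0.
have N1 : -1 <= -1 :> R by []. have P1 : 1 <= 1 :> R by [].
have N11 : -1 <= 1 :> R by lra.
have [sN sP] := sinM_end; have [cN cP] := cosM_end.
have [c2 _ _] := AC2; have [c3 _ _] := AC3.
have w2N : w2 (-1) = 0 by rewrite q2N sN; ring.
have w2P : w2 1 = 0 by rewrite q2P sP; ring.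
have w20 : w2 0 = q2 0 by rewrite mulr0 sin0 mulr0 addr0.
have mass : 2 * (rho ^+ 2 - eta) <= intg (-1) 1 (fun x => q2 x ^+ 2 + q3 x ^+ 2).
  have -> : 2 * (rho ^+ 2 - eta) = intg (-1) 1 (fun=> rho ^+ 2 - eta).
    by rewrite intg_cst//; ring.
  apply: intg_le => //; first exact: inL1_cst.
    by apply: wcont_L1; apply: wcontD; exact: wcontX.
  move=> x /andP[/ltW x1 /ltW x2]; have hx : -1 <= x <= 1 by rewrite x1.
  by have := tub x hx; rewrite ler_norml => /andP[? ?]; lra.
have sum_le := ler_wpM2l (sqr_ge0 k) mass.
have close x : -1 <= x <= 1 ->
    `|w2 x - q2 0 * C x| <= e /\ `|q3 x - q3 0 * C x| <= e.
  move=> hx; have h1 := poincare_defect primL2_w2 w2N w2P hx.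
  have h2' := poincare_defect AC3 q3N q3P hx.
  have := poincare_sum; move: h1 h2'; rewrite /= w20.
  set A := _ - q2 0 * _; set B := q3 x - _ => h1 h2' hs.
  have A0 := sqr_ge0 A; have B0 := sqr_ge0 B.
  have tot : k * (A ^+ 2 + B ^+ 2) <= k * (pi * eta).
    rewrite mulrDr; apply: le_trans (lerD h1 h2') _; rewrite hs.
    move: sum_le E; rewrite (_ : k * (pi * eta) = 2 * k ^+ 2 * eta); last by field.
    lra.
  rewrite ler_pM2l// in tot.
  split; rewrite -(@ler_pXn2r _ 2) ?nnegrE ?(ltW e0)// real_normK ?num_real//; lra.
have [C0 [SC CC]] := eighth_turn.
have h0 : (-1 <= 0 :> R) && (0 <= 1 :> R) by apply/andP; split; lra.
have hh : (-1 <= 1 / 2 :> R) && (1 / 2 <= 1 :> R) by apply/andP; split; lra.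
have [d1 d2] := close _ hh.
have t0 := le_trans (tub 0 h0) ee.
have th : `|(- rho * C (1 / 2) + q2 0 * C (1 / 2)
   + (w2 (1 / 2) - q2 0 * C (1 / 2))) ^+ 2
   + (q3 0 * C (1 / 2) + (q3 (1 / 2) - q3 0 * C (1 / 2))) ^+ 2 - rho ^+ 2| <= e.
  apply: le_trans ee; have := tub _ hh; congr (`|_ - _| <= _).
  by rewrite SC; ring.
have [ha hb] := rigidity_two_points r0 e0 e1 b0 C0 CC t0 d1 d2 th.
move=> x hx; have [f2 f3] := close x hx.
have cx : `|C x| <= 1.
  by rewrite ler_norml; have := cos2Dsin2 (k * x); have := sqr_ge0 (S x);
    move=> ? ?; apply/andP; split; nra.
split; last split => //.
  have : `|w2 x| <= e + `|q2 0|.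
    rewrite -[w2 x](subrK (q2 0 * C x)).
    apply: le_trans (ler_normD _ _) _; apply: lerD => //.
    by rewrite normrM ler_piMr.
  by move=> /(ler_wpM2l (ltW r0)); lra.
have : `|w3 x| <= e + `|q3 0 - rho|.
  rewrite (_ : q3 x - _ = (q3 x - q3 0 * C x) + (q3 0 - rho) * C x);
    last by ring.
  apply: le_trans (ler_normD _ _) _; apply: lerD => //.
  by rewrite normrM ler_piMr.
by move=> /(ler_wpM2l (ltW r0)); lra.
Qed.

End Planar.

End Rigidity.

(** * Convergence of the components *)

Section Components.
Context {R : realType}.
Implicit Types (u v f g : R -> R) (a b c r e x k m s : R).

Lemma primL2_sqr_bound u g x : primL2 u g -> u (-1) = 0 -> -1 <= x <= 1 ->
  u x ^+ 2 <= 2 * intg (-1) 1 (fun x => g x ^+ 2).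
Proof.
move=> ACu u0 hx.
have N11 : (-1 <= -1 :> R) && (-1 <= 1 :> R) by apply/andP; split; lra.
have := primL2_holder_norm ACu (lexx _) N11 hx; rewrite u0 subr0.
move=> /le_trans; apply; apply: ler_wpM2r.
  by apply: intg_ge0 => y _; exact: sqr_ge0.
by move/andP: hx => [? ?]; rewrite ger0_norm; lra.
Qed.

Lemma primL2_L2_bound u g : primL2 u g -> u (-1) = 0 ->
  intg (-1) 1 (fun x => u x ^+ 2) <= 4 * intg (-1) 1 (fun x => g x ^+ 2).
Proof.
move=> ACu u0; have [cu _ _] := ACu.
have N11 : -1 <= 1 :> R by lra.
set G := intg _ _ (fun x => g x ^+ 2).
have -> : 4 * G = intg (-1) 1 (fun=> 2 * G) by rewrite intg_cst//; ring.
apply: intg_le => //; [exact: inL2_sqr (wcont_L2 cu)|exact: inL1_cst|].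
by move=> x /andP[/ltW x1 /ltW x2]; apply: primL2_sqr_bound => //; rewrite x1.
Qed.

Definition qstar (s : R) : triple R :=
  Triple (fun=> s) (fun x => - (3 * s) * sin (pi / 2 * x))
         (fun x => 3 * s * cos (pi / 2 * x)).

Definition dqstar (s : R) : triple R :=
  Triple (fun=> 0) (fun x => - (3 * s) * (pi / 2 * cos (pi / 2 * x)))
         (fun x => 3 * s * - (pi / 2 * sin (pi / 2 * x))).

Lemma qstar_primL2 s : [/\ primL2 (q1 (qstar s)) (q1 (dqstar s)),
  primL2 (q2 (qstar s)) (q2 (dqstar s)) &
  primL2 (q3 (qstar s)) (q3 (dqstar s))].
Proof.
by split; [exact: primL2_cst|apply: primL2Z; exact: primL2_sinM|
  apply: primL2Z; exact: primL2_cosM].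
Qed.

Definition triple_sub (q p : triple R) : triple R :=
  Triple (fun x => q1 q x - q1 p x) (fun x => q2 q x - q2 p x)
         (fun x => q3 q x - q3 p x).

(** Half of the squared norm of the derivative of a tensor of the block form. *)
Definition kinetic (g : triple R) (x : R) : R :=
  3 * q1 g x ^+ 2 + q2 g x ^+ 2 + q3 g x ^+ 2.

Lemma kinetic_L1 (g : triple R) : inL2 (q1 g) -> inL2 (q2 g) -> inL2 (q3 g) ->
  inL1 (kinetic g).
Proof.
move=> /inL2_sqr i1 /inL2_sqr i2 /inL2_sqr i3.
by apply: inL1D => //; apply: inL1D => //; exact: inL1Z.
Qed.

Lemma kinetic_parts (g : triple R) : inL2 (q1 g) -> inL2 (q2 g) -> inL2 (q3 g) ->
  [/\ intg (-1) 1 (fun x => q1 g x ^+ 2) <= intg (-1) 1 (kinetic g),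
      intg (-1) 1 (fun x => q2 g x ^+ 2) <= intg (-1) 1 (kinetic g),
      intg (-1) 1 (fun x => q3 g x ^+ 2) <= intg (-1) 1 (kinetic g) &
      intg (-1) 1 (fun x => q2 g x ^+ 2 + q3 g x ^+ 2)
        <= intg (-1) 1 (kinetic g)].
Proof.
move=> h1 h2 h3; have ik := kinetic_L1 h1 h2 h3.
move/inL2_sqr: h1 => h1; move/inL2_sqr: h2 => h2; move/inL2_sqr: h3 => h3.
by split; apply: intg_le => //; try exact: inL1D; move=> x _; rewrite /kinetic;
  have := sqr_ge0 (q1 g x); have := sqr_ge0 (q2 g x);
  have := sqr_ge0 (q3 g x); lra.
Qed.

(** The conclusions of [confinement], [close_to_geodesic] and [kinetic_gap] chained
together: e is chosen from eps so that the final bound M e is at most eps, and the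
width eta of the tube is then chosen from e. *)
Lemma minimizers_close (theta c s eps : R) : 0 < s -> 0 < eps ->
  (forall a m, 0 <= m -> 0 <= potential theta c a m) ->
  (forall a m, 0 <= m -> potential theta c a m = 0 -> m = 0 \/ m = (3 * s) ^+ 2) ->
  exists2 L : R, 0 < L & forall (lambda : R) (q g : triple R), L <= lambda ->
    primL2 (q1 q) (q1 g) -> primL2 (q2 q) (q2 g) -> primL2 (q3 q) (q3 g) ->
    q1 q (-1) = s -> q2 q (-1) = 3 * s -> q3 q (-1) = 0 ->
    q1 q 1 = s -> q2 q 1 = - (3 * s) -> q3 q 1 = 0 -> 0 <= q3 q 0 ->
    intg (-1) 1 (kinetic g) + lambda ^+ 2 * intg (-1) 1
      (fun x => potential theta c (q1 q x) (q2 q x ^+ 2 + q3 q x ^+ 2))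
      <= 2 * (3 * s) ^+ 2 * (pi / 2) ^+ 2 ->
    intg (-1) 1 (kinetic (triple_sub g (dqstar s))) <= eps.
Proof.
move=> s0 eps0 F0 F1; set rho := 3 * s; set K := 2 * rho ^+ 2 * _.
have r0 : 0 < rho by rewrite /rho; lra.
have p0 := pi_gt0 R.
have k0 : 0 < pi / 2 :> R by lra.
have K0 : 0 < K.
  by apply: mulr_gt0; [apply: mulr_gt0 => //|]; exact: exprn_gt0.
(* e D bounds |w2| and |w3| by [close_to_geodesic], and M e is the resulting bound
   of [kinetic_gap]. *)
pose D := ((7 * rho + 8) + (rho + 1) + (6 * rho + 8) ^+ 2 / rho ^+ 2) / rho.
have D0 : 0 < D.
  by rewrite divr_gt0// ltr_wpDr ?divr_ge0 ?sqr_ge0//; lra.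
pose M := 8 * rho * (pi / 2) ^+ 2 * D.
have M0 : 0 < M.
  apply: mulr_gt0 => //; apply: mulr_gt0; last exact: exprn_gt0.
  by apply: mulr_gt0.
pose e := Num.min 1 (eps / M).
have e0 : 0 < e by rewrite lt_min ltr01 divr_gt0.
have e1 : e <= 1 by rewrite ge_min lexx.
have eM : M * e <= eps by rewrite mulrC -ler_pdivlMr// ge_min lexx orbT.
pose eta := Num.min e (Num.min (e ^+ 2 / pi) (rho ^+ 2 / 2)).
have eta0 : 0 < eta.
  by rewrite /eta lt_min e0 lt_min /=; apply/andP; split;
    rewrite divr_gt0 ?exprn_gt0.
have eta1 : eta <= e by rewrite ge_min lexx.
have eta2 : pi * eta <= e ^+ 2.
  by rewrite mulrC -ler_pdivlMr// !ge_min lexx !orbT.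
have eta3 : 2 * eta <= rho ^+ 2.
  by rewrite mulrC -ler_pdivlMr// !ge_min lexx !orbT.
have [L L0 tub] := confinement F0 F1 s0 K0 eta0 eta3.
exists L => // lambda q g lL A1 A2 A3 n1 n2 n3 m1 m2 m3 pos E.
have [c1 l1 _] := A1; have [c2 l2 _] := A2; have [c3 l3 _] := A3.
pose V x := potential theta c (q1 q x) (q2 q x ^+ 2 + q3 q x ^+ 2).
have V0 : 0 <= intg (-1) 1 V.
  by apply: intg_ge0 => x _; apply: F0; rewrite addr_ge0 ?sqr_ge0.
have [k1 k2 k3 k23] := kinetic_parts l1 l2 l3.
have kin0 : 0 <= intg (-1) 1 (kinetic g).
  apply: intg_ge0 => x _; rewrite /kinetic; have := sqr_ge0 (q1 g x).
  by have := sqr_ge0 (q2 g x); have := sqr_ge0 (q3 g x); lra.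
have lV : 0 <= lambda ^+ 2 * intg (-1) 1 V by rewrite mulr_ge0 ?sqr_ge0.
have kK : intg (-1) 1 (kinetic g) <= K.
  by apply: le_trans E; rewrite lerDl.
have VK : lambda ^+ 2 * intg (-1) 1 V <= K by apply: le_trans E; rewrite lerDr.
have tubx := tub lambda q g lL A1 A2 A3 n1 n2 n3 (le_trans k1 kK)
  (le_trans k2 kK) (le_trans k3 kK) VK.
have ang := close_to_geodesic A2 A3 n2 m2 n3 m3 r0 e0 e1 eta1 eta2 pos
  (le_trans k23 kK) tubx.
have bd (w X : R) : rho * w <= e * X -> X <= rho * D -> w <= e * D.
  move=> h1 h2; rewrite -(ler_pM2l r0); apply: le_trans h1 _.
  by rewrite mulrCA ler_pM2l.
have rD : rho * D = (7 * rho + 8) + (rho + 1) + (6 * rho + 8) ^+ 2 / rho ^+ 2.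
  by rewrite mulrC mulfVK ?gt_eqF.
have sq0 : 0 <= (6 * rho + 8) ^+ 2 / rho ^+ 2 by rewrite divr_ge0 ?sqr_ge0.
have W2 x : -1 <= x <= 1 -> `|q2 q x + rho * sin (pi / 2 * x)| <= e * D.
  by move=> /ang[h _]; apply: bd h _; rewrite rD; lra.
have W3 x : -1 <= x <= 1 -> `|q3 q x - rho * cos (pi / 2 * x)| <= e * D.
  move=> /ang[_ [h ha]]; apply: (bd _ ((rho + 1) + (6 * rho + 8) ^+ 2 / rho ^+ 2)).
    apply: le_trans h _; rewrite [leRHS]mulrDr lerD2l.
    rewrite -(ler_pM2l (exprn_gt0 2 r0)) -[q2 q 0 ^+ 2]real_normK ?num_real//.
    rewrite -exprMn mulrCA [_ ^+ 2 * (_ / _)]mulrC mulfVK ?gt_eqF ?exprn_gt0//.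
    apply: (@le_trans _ _ ((e * (6 * rho + 8)) ^+ 2)).
      rewrite ler_pXn2r ?nnegrE//; last 1 first.
        by rewrite mulr_ge0 ?(ltW e0)//; lra.
      by rewrite mulr_ge0 ?(ltW r0).
    by rewrite exprMn ler_wpM2r ?sqr_ge0// expr2 ler_piMl ?(ltW e0).
  by rewrite rD; lra.
have := kinetic_gap A2 A3 n3 m3 l1 kK (ltW r0) W2 W3.
rewrite (_ : _ * _ * (e * D) = M * e); last by rewrite /M; ring.
move=> /le_trans /(_ eM); apply: le_trans; rewrite le_eqVlt; apply/orP; left.
apply/eqP; apply: eq_intg => x _; rewrite /kinetic /= -/rho; ring.
Qed.

End Components.

(** * Energies, norms and the zeros of the potential *)

Section Assembly.
Context {R : realType}.
Implicit Types (u v f g : R -> R) (a b c r e x k m s : R).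
Local Notation mu := (@lebesgue_measure R).
Local Notation Io := (@Iopen R).
Local Notation Ic := (@Iclosed R).

Lemma energyE (theta c lambda : R) (q g : triple R) :
  primL2 (q1 q) (q1 g) -> primL2 (q2 q) (q2 g) -> primL2 (q3 q) (q3 g) ->
  lambda != 0 ->
  energy theta c lambda q = (lambda ^- 2 * (intg (-1) 1 (kinetic g)
    + lambda ^+ 2 * intg (-1) 1
      (fun x => potential theta c (q1 q x) (q2 q x ^+ 2 + q3 q x ^+ 2))))%:E.
Proof.
move=> A1 A2 A3 l0.
have [c1 l1 _] := A1; have [c2 l2 _] := A2; have [c3 l3 _] := A3.
have ik := kinetic_L1 l1 l2 l3.
have cV := wcont_potential (theta := theta) (c := c) c1 c2 c3.
rewrite /energy.
under eq_integral do rewrite bulk_Qmat.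
rewrite (integral_normsq_wderivmx _ A1 A2 A3 cV); congr EFin.
have N1 : -1 <= -1 :> R by []. have P1 : 1 <= 1 :> R by [].
set B := intg _ _ (fun x => potential _ _ _ _); set A := intg _ _ (kinetic g).
rewrite (_ : lambda ^- 2 * _ = lambda ^- 2 * A + B); last by field.
rewrite -(intgZ N1 P1 _ ik).
rewrite -(intgD N1 P1 (inL1Z _ ik) (wcont_L1 cV)).
by apply: eq_intg => x _; rewrite /kinetic; field.
Qed.

(** A function vanishing at -1 has squared L^2 norm at most 4 times that of its
derivative; this gives the factor 2 + 2 * 4. *)
Lemma H1norm_Qmat_le (w h : triple R) : primL2 (q1 w) (q1 h) ->
  primL2 (q2 w) (q2 h) -> primL2 (q3 w) (q3 h) ->
  q1 w (-1) = 0 -> q2 w (-1) = 0 -> q3 w (-1) = 0 ->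
  exists2 v : R, 0 <= v <= 10 * intg (-1) 1 (kinetic h) &
    H1norm (Qmat w) = (Num.sqrt v)%:E.
Proof.
move=> A1 A2 A3 w1 w2 w3.
have [c1 l1 _] := A1; have [c2 l2 _] := A2; have [c3 l3 _] := A3.
have ik := kinetic_L1 l1 l2 l3; have ikw := kinetic_L1 (wcont_L2 c1)
  (wcont_L2 c2) (wcont_L2 c3).
have cV : {within Ic, continuous (fun x => 2 * kinetic w x)}.
  by apply: wcontZ; apply: wcontD; [apply: wcontD|]; rewrite ?wcontZ//;
    do ?apply: wcontZ; exact: wcontX.
have N1 : -1 <= -1 :> R by []. have P1 : 1 <= 1 :> R by [].
exists (2 * intg (-1) 1 (kinetic h) + 2 * intg (-1) 1 (kinetic w)).
  have kin0 (t : triple R) : 0 <= intg (-1) 1 (kinetic t).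
    apply: intg_ge0 => x _; rewrite /kinetic; have := sqr_ge0 (q1 t x).
    by have := sqr_ge0 (q2 t x); have := sqr_ge0 (q3 t x); lra.
  have kinD (t : triple R) : inL2 (q1 t) -> inL2 (q2 t) -> inL2 (q3 t) ->
      intg (-1) 1 (kinetic t) = 3 * intg (-1) 1 (fun x => q1 t x ^+ 2)
      + intg (-1) 1 (fun x => q2 t x ^+ 2) + intg (-1) 1 (fun x => q3 t x ^+ 2).
    move=> /inL2_sqr i1 /inL2_sqr i2 /inL2_sqr i3; rewrite /kinetic.
    rewrite (intgD N1 P1 (inL1D (inL1Z 3 i1) i2) i3).
    by rewrite (intgD N1 P1 (inL1Z 3 i1) i2) (intgZ N1 P1 3 i1).
  have := primL2_L2_bound A1 w1; have := primL2_L2_bound A2 w2.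
  have := primL2_L2_bound A3 w3; have := kin0 w; have := kin0 h.
  rewrite (kinD h l1 l2 l3) (kinD w (wcont_L2 c1) (wcont_L2 c2) (wcont_L2 c3)).
  by move=> ? ? ? ? ?; apply/andP; split; lra.
have -> : H1norm (Qmat w) = sqrte (\int[mu]_(x in Io)
    (1 * normsq (wderivmx (Qmat w) x) + 2 * kinetic w x)%:E)%E.
  rewrite /H1norm; congr sqrte; apply: eq_integral => x _.
  by rewrite normsq_Qmat /kinetic; congr EFin; ring.
rewrite (integral_normsq_wderivmx _ A1 A2 A3 cV) /sqrte; congr (Num.sqrt _)%:E.
rewrite -!(intgZ N1 P1)// -(intgD N1 P1 (inL1Z 2 ik) (inL1Z 2 ikw)).
by apply: eq_intg => x _; rewrite /kinetic; ring.
Qed.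

Lemma qplus_gt0 (theta : R) : 0 < qplus theta.
Proof. by rewrite divr_gt0// ltr_wpDr// sqrtr_ge0. Qed.

Lemma nstar_unit x : unit_vector (nstar x).
Proof.
by rewrite /unit_vector !big_ord_recl big_ord0 !mxE /= expr0n add0r addr0 cos2Dsin2.
Qed.

(** The director has angle y = pi / 4 - pi / 4 x, and 2 y = pi / 2 - pi / 2 x:
the entries match by the double-angle formulas. *)
Lemma Qstar_Qmat (theta : R) x : Qstar theta x = Qmat (qstar (qplus theta)) x.
Proof.
rewrite /Qstar /uniaxial; set s := qplus theta; set y := pi / 4 - pi / 4 * x.
have hc : cos y ^+ 2 + sin y ^+ 2 = 1 by exact: cos2Dsin2.
have y2 : y + y = pi / 2 - pi / 2 * x by rewrite /y; field.
have hs : sin (pi / 2 * x) = cos y ^+ 2 - sin y ^+ 2.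
  rewrite !expr2 -cosD y2 cosB cos_pihalf sin_pihalf; ring.
have hd : cos (pi / 2 * x) = 2 * (cos y * sin y).
  have -> : cos (pi / 2 * x) = sin (y + y).
    by rewrite y2 sinB cos_pihalf sin_pihalf; ring.
  by rewrite sinD; ring.
have e3 : 3 * s = 3 * s * (cos y ^+ 2 + sin y ^+ 2) by rewrite hc mulr1.
have sc : sin y ^+ 2 = 1 - cos y ^+ 2 by rewrite -hc; ring.
apply/matrixP; do 2 apply: ord3_ind;
  rewrite !mxE !big_ord_recl big_ord0 !mxE /= ?hs ?hd -/y;
  move: sc; rewrite ?expr2 => sc; rewrite ?sc ?mulr1n ?mulr0n; try (by field).
Qed.

Lemma Qmat_triple_sub (q p : triple R) x :
  Qmat q x - Qmat p x = Qmat (triple_sub q p) x.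
Proof.
by apply/matrixP; do 2 apply: ord3_ind; rewrite !mxE /=; ring.
Qed.

Section Bulk.
Variables theta c : R.
Hypothesis min_zero : bulk_min_zero theta c.
Hypothesis min_uniaxial : forall A : 'M[R]_3, bulk_minimizer theta c A <->
     exists n : 'cV[R]_3, unit_vector n /\ A = uniaxial theta n.

Lemma bulk_ge0 (A : 'M[R]_3) : sym_traceless A -> 0 <= bulk theta c A.
Proof. by case: min_zero => B [[_ hB] <-]; exact: hB. Qed.

Lemma bulk_uniaxial_eq0 (n : 'cV[R]_3) : unit_vector n ->
  bulk theta c (uniaxial theta n) = 0.
Proof.
move=> un; have [sn hmin] : bulk_minimizer theta c (uniaxial theta n).
  by apply/min_uniaxial; exists n.
have [B [[sB hB] B0]] := min_zero; apply/le_anti; rewrite -{1}B0 hmin//=.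
exact: bulk_ge0.
Qed.

Lemma potential_ge0 a m : 0 <= m -> 0 <= potential theta c a m.
Proof.
move=> m0; have := bulk_ge0 (Qmat_sym_traceless
  (Triple (fun=> a) (fun=> Num.sqrt m) (fun=> 0)) 0).
by rewrite bulk_Qmat /= sqr_sqrtr// expr0n addr0.
Qed.

(** A zero comes from a uniaxial tensor of the block form with q3 = 0. Its vanishing
off-diagonal entries force the director n to be either parallel to the first axis,
which gives m = 0, or orthogonal to it, which gives m = (3 q_+) ^ 2. *)
Lemma potential_eq0 a m : 0 <= m -> potential theta c a m = 0 ->
  m = 0 \/ m = (3 * qplus theta) ^+ 2.
Proof.
move=> m0 pm0; have s0 := qplus_gt0 theta.
pose t : triple R := Triple (fun=> a) (fun=> Num.sqrt m) (fun=> 0).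
have t0 : bulk theta c (Qmat t 0) = 0.
  by rewrite bulk_Qmat /= sqr_sqrtr// expr0n addr0.
have : bulk_minimizer theta c (Qmat t 0).
  split; first exact: Qmat_sym_traceless.
  by move=> B; rewrite t0; exact: bulk_ge0.
move=> /min_uniaxial[n [un /matrixP tn]].
have r2 : Num.sqrt m ^+ 2 = m by exact: sqr_sqrtr.
pose i0 : 'I_3 := ord0; pose i1 : 'I_3 := lift ord0 ord0.
pose i2 : 'I_3 := lift ord0 (lift ord0 ord0).
have ent i j : Qmat t 0 i j =
    6 * qplus theta * (n i 0 * n j 0 - (1 / 3) *+ (i == j)).
  by rewrite tn !mxE big_ord_recl big_ord0 !mxE addr0.
have un1 : n i0 0 ^+ 2 + n i1 0 ^+ 2 + n i2 0 ^+ 2 = 1.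
  by rewrite -un !big_ord_recl big_ord0 addr0 addrA.
have := ent i0 i1; have := ent i0 i2; have := ent i1 i2.
have := ent i1 i1; have := ent i2 i2; rewrite !mxE /= !mulr1n !mulr0n !subr0.
move: un1; set x := n i0 _; set y := n i1 _; set z := n i2 _; set r := Num.sqrt m.
set s := qplus theta in s0 *; move=> un1 e22 e11 e12 e02 e01.
have nz (u v : R) : 0 = 6 * s * (u * v) -> u * v = 0.
  by move=> /esym/eqP; rewrite mulf_eq0 gt_eqF/= => [/eqP//|]; rewrite mulr_gt0.
have yz := nz _ _ e12; have xz := nz _ _ e02; have xy := nz _ _ e01.
have rE : r = 3 * s * (z ^+ 2 - y ^+ 2).
  have -> : r = ((a + r) - (a - r)) / 2 by field.
  by rewrite e22 e11; field.
rewrite -r2 -/r rE.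
have [x0|x0] := eqVneq x 0; [right|left].
  have zy : z ^+ 2 = 1 - y ^+ 2 by move: un1; rewrite x0 expr0n add0r => <-; ring.
  have yz2 : y ^+ 2 * z ^+ 2 = 0 by rewrite -exprMn yz expr0n.
  rewrite exprMn (_ : (z ^+ 2 - y ^+ 2) ^+ 2 =
    (z ^+ 2 + y ^+ 2) ^+ 2 - 4 * (y ^+ 2 * z ^+ 2)); last by ring.
  by rewrite yz2 zy subrK; ring.
have y0 : y = 0 by move/eqP: xy; rewrite mulf_eq0 (negPf x0) => /eqP.
have z0 : z = 0 by move/eqP: xz; rewrite mulf_eq0 (negPf x0) => /eqP.
by rewrite y0 z0 subrr mulr0 expr0n.
Qed.

End Bulk.

Lemma qstar_inH (theta : R) : inH theta (qstar (qplus theta)).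
Proof.
have [A1 A2 A3] := qstar_primL2 (qplus theta).
have [sN sP] := @sinM_end R; have [cN cP] := @cosM_end R.
split.
  by split; [exact: primL2_inH1 A1|exact: primL2_inH1 A2|exact: primL2_inH1 A3].
by split=> //=; rewrite ?sN ?sP ?cN ?cP ?mulr0 ?mulrN1 ?mulr1 ?opprK.
Qed.

Lemma energy_qstar (theta c lambda : R) : bulk_min_zero theta c ->
  (forall A : 'M[R]_3, bulk_minimizer theta c A <->
     exists n : 'cV[R]_3, unit_vector n /\ A = uniaxial theta n) ->
  lambda != 0 ->
  energy theta c lambda (qstar (qplus theta)) =
    (lambda ^- 2 * (2 * (3 * qplus theta) ^+ 2 * (pi / 2) ^+ 2))%:E.
Proof.
move=> hz hu l0; set s := qplus theta; have [A1 A2 A3] := qstar_primL2 s.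
rewrite (energyE _ _ A1 A2 A3 l0); congr (_ * _)%:E.
have N11 : -1 <= 1 :> R by lra.
rewrite (@eq_intg _ _ _ _ (fun=> (3 * s) ^+ 2 * (pi / 2) ^+ 2)); last first.
  move=> x _; rewrite /kinetic /=; have := cos2Dsin2 (pi / 2 * x).
  set C := cos _; set S := sin _ => CS.
  rewrite -[RHS]mulr1 -CS; ring.
rewrite [X in _ + _ * X](@eq_intg _ _ _ _ (fun=> 0)); last first.
  move=> x _; rewrite -bulk_Qmat -Qstar_Qmat.
  exact: (bulk_uniaxial_eq0 hz hu (nstar_unit x)).
by rewrite !intg_cst//; ring.
Qed.

End Assembly.

(** * Convergence of the minimizers *)

Unset Implicit Arguments.

Theorem proposition4p1 (R : realType) (theta c : R) (Q : R -> triple R)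
  (theta_lt1 : theta < 1)
  (min_f_zero : bulk_min_zero theta c)
  (min_f_uniaxial : forall A : 'M[R]_3,
     bulk_minimizer theta c A <->
     exists n : 'cV[R]_3, unit_vector n /\ A = uniaxial theta n)
  (Q_min : forall lambda : R, 0 < lambda ->
     energy_minimizer theta c lambda (Q lambda) /\ 0 <= q3 (Q lambda) 0) :
  H1norm (fun x : R => Qmat (Q lambda) x - Qstar theta x)
    @[lambda --> +oo] --> 0%E.
Proof.
have s0 := qplus_gt0 theta; set s := qplus theta in s0.
have close eps : 0 < eps -> \forall lambda \near +oo,
    exists2 v, 0 <= v <= eps &
      H1norm (fun x : R => Qmat (Q lambda) x - Qstar theta x) = (Num.sqrt v)%:E.
  move=> eps0; have eps10 : 0 < eps / 10 by rewrite divr_gt0.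
  have [L L0 hL] := minimizers_close s0 eps10
    (potential_ge0 min_f_zero) (potential_eq0 min_f_zero min_f_uniaxial).
  near=> lambda.
  have lL : L <= lambda by near: lambda; apply: nbhs_pinfty_ge; rewrite num_real.
  have l0 : 0 < lambda by exact: lt_le_trans lL.
  have ln0 : lambda != 0 by rewrite gt_eqF.
  have [[[[H1 H2 H3] [[n1 m1] [n2 m2] [n3 m3]]] hmin] pos] := Q_min _ l0.
  set q := Q lambda in H1 H2 H3 n1 n2 n3 m1 m2 m3 hmin pos *.
  pose g := Triple (wderiv (q1 q)) (wderiv (q2 q)) (wderiv (q3 q)).
  have A1 : primL2 (q1 q) (q1 g) by exact: inH1_primL2.
  have A2 : primL2 (q2 q) (q2 g) by exact: inH1_primL2.
  have A3 : primL2 (q3 q) (q3 g) by exact: inH1_primL2.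
  have := hmin _ (qstar_inH theta).
  rewrite (energyE _ _ A1 A2 A3 ln0) (energy_qstar min_f_zero min_f_uniaxial ln0).
  rewrite lee_fin ler_pM2l ?invr_gt0 ?exprn_gt0//.
  move=> /(hL _ _ _ lL A1 A2 A3 n1 n2 n3 m1 m2 m3 pos) kin.
  have [S1 S2 S3] := qstar_primL2 s.
  have [sN _] := @sinM_end R; have [cN _] := @cosM_end R.
  have [||||||v /andP[v0 v1] vE] := @H1norm_Qmat_le R
    (triple_sub q (qstar s)) (triple_sub g (dqstar s)).
  - exact: primL2B.
  - exact: primL2B.
  - exact: primL2B.
  - by rewrite /= n1 subrr.
  - by rewrite /= n2 sN mulrN1 opprK subrr.
  - by rewrite /= n3 cN mulr0 subrr.
  exists v; first by rewrite v0 (le_trans v1)//; lra.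
  rewrite -vE; congr H1norm; apply/funext => x.
  by rewrite Qstar_Qmat Qmat_triple_sub.
apply/fine_cvgP; split.
  have := close 1 ltr01; apply: filterS => lambda [v _ ->]; exact: fin_numE.
apply/cvgrPdist_le => eps eps0.
have := close (eps ^+ 2) (exprn_gt0 2 eps0).
apply: filterS => lambda [v /andP[v0 v1] vE].
rewrite /= vE /= sub0r normrN ger0_norm ?sqrtr_ge0//.
rewrite -[leRHS](ger0_norm (ltW eps0)) -sqrtr_sqr ler_sqrt//.
exact: sqr_ge0.
Unshelve. all: by end_near. Qed.
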